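(* Consider the stochastic multidimensional knapsack problem described in the context. For any constants $d\in\mathbb{N}$, $\epsilon>0$ and $0\le\gamma\le1$, there is a polynomial time algorithm finding a set $S\subseteq U$ of items such that the total profit $v(S)$ is at least $(1-\epsilon)$ times the optimum and $\Pr\bigl(\bigwedge_{j=1}^{d}(\sum_{i\in S}w_{ij}\le1+\epsilon)\bigr)\ge(1-\epsilon)\gamma$.
   Context: Stochastic multidimensional knapsack: a set $U$ of $n$ items and a constant $0\le\gamma\le1$ are given. Item $i$ has a deterministic nonnegative integer profit $v_i$ and a random size vector $\mathbf{w}_i=(w_{i1},\dots,w_{id})$ with nonnegative components; the components of a single vector may be arbitrarily correlated, while the vectors of different items are mutually independent (and $\mathbb{E}[\phi^{k\cdot\mathbf{w}_i}]$ is computable for complex $|\phi|\le1$ and integer vectors $k$). For $S\subseteq U$, $v(S)=\sum_{i\in S}v_i$. The optimum is $\max\{v(S): S\subseteq U,\ \Pr(\bigwedge_{j=1}^{d}(\sum_{i\in S}w_{ij}\le1))\ge\gamma\}$. *)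

(* Defs.v *)
(* MathComp / MathComp-Analysis. *)
From HB Require Import structures.
From mathcomp Require Import all_boot all_order all_algebra.
From mathcomp Require Import complex.
From mathcomp Require Import all_classical all_reals all_analysis.

Set Implicit Arguments.
Unset Strict Implicit.
Unset Printing Implicit Defensive.

Import Order.TTheory GRing.Theory Num.Theory.
Import numFieldNormedType.Exports.

Local Open Scope classical_set_scope.
Local Open Scope ring_scope.

(** * Stochastic multidimensional knapsack *)

Section Knapsack.
Context {R : realType} {disp : measure_display} {T : measurableType disp}.
Variables (P : probability T R) (n d : nat).
Implicit Types (v : 'I_n -> nat) (w : 'I_n -> 'I_d -> {RV P >-> R}).
Implicit Types (S : {set 'I_n}).

(* [g_sigma_preimage (w i)] is the sigma-algebra generated by the random
   vector (w i 0, ..., w i (d-1)). *)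
Definition mutually_independent w : Prop :=
  forall (J : {set 'I_n}) (A : 'I_n -> set T),
    (forall i, i \in J ->
      g_sigma_preimage (fun j : 'I_d => w i j : T -> R) (A i)) ->
    P (\bigcap_(i in [set` J]) A i) = (\prod_(i in J) P (A i))%E.

Definition profit v S : nat := \sum_(i in S) v i.

Definition fits w S (c : R) : set T :=
  [set t | forall j : 'I_d, \sum_(i in S) w i j t <= c].

(* For gamma <= 1 and nonnegative sizes, S = set0 is feasible, so that this
   is the maximum over a nonempty family. *)
Definition optimum v w (gamma : R) : nat :=
  \max_(S : {set 'I_n} | (gamma%:E <= P (fits w S 1))%E) profit v S.

End Knapsack.

(** * Complex powers with a real exponent *)

Section ComplexPower.
Context {R : realType}.

(* principal argument, in ]-pi, pi] *)
Definition carg (z : R[i]) : R :=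
  let theta := acos (complex.Re z / Normc.normc z) in
  if 0 <= complex.Im z then theta else - theta.

(* z^x = |z|^x e^(i x arg z); in particular 0^0 = 1 and 0^x = 0 for x > 0. *)
Definition cpow (z : R[i]) (x : R) : R[i] :=
  let r := Normc.normc z `^ x in
  Complex (r * cos (x * carg z)) (r * sin (x * carg z)).

Context {disp : measure_display} {T : measurableType disp}.
Variable P : probability T R.

Definition cintegrable (Z : T -> R[i]) : Prop :=
  P.-integrable setT (EFin \o (fun t => complex.Re (Z t))) /\
  P.-integrable setT (EFin \o (fun t => complex.Im (Z t))).

Definition cexpectation (Z : T -> R[i]) : R[i] :=
  Complex (fine 'E_P[fun t => complex.Re (Z t)])
          (fine 'E_P[fun t => complex.Im (Z t)]).

End ComplexPower.

(** * Access to the size distributions *)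

(* A query asks for E[phi^(k . w_i)], with i = [qitem], k = [qfreq] and the
   Gaussian rational phi = ([qre] + [qim] 'i) / [qden], up to a precision of
   [qprec] binary digits. An answer (x, y) stands for (x + y 'i) / 2^[qprec]. *)
Record query (d : nat) := Query {
  qitem : int; qre : int; qim : int; qden : int;
  qfreq : {ffun 'I_d -> int}; qprec : nat }.

Definition oracle (d : nat) := query d -> int * int.

Section Oracle.
Context {R : realType} {disp : measure_display} {T : measurableType disp}.
Variables (P : probability T R) (n d : nat).
Variable w : 'I_n -> 'I_d -> {RV P >-> R}.

Definition qphi (q : query d) : R[i] :=
  Complex ((qre q)%:~R / (qden q)%:~R) ((qim q)%:~R / (qden q)%:~R).

Definition qpower (q : query d) (i : 'I_n) (t : T) : R[i] :=
  cpow (qphi q) (\sum_(j < d) (qfreq q j)%:~R * w i j t).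

(* The answer is constrained for |phi| <= 1 whenever E[phi^(k . w_i)] exists
   (for |phi| < 1 and k with negative entries it may diverge, and for phi = 0
   the power itself may be undefined); any other answer is arbitrary. *)
Definition oracle_spec (O : oracle d) : Prop :=
  forall (q : query d) (i : 'I_n),
    qitem q = (i : nat)%:Z -> qden q != 0 ->
    Normc.normc (qphi q) <= 1 ->
    (qphi q != 0 \/ forall j, 0 <= qfreq q j) ->
    cintegrable P (qpower q i) ->
    let E := cexpectation P (qpower q i) in
    `| 2 ^+ qprec q * complex.Re E - (O q).1%:~R | <= 1 /\
    `| 2 ^+ qprec q * complex.Im E - (O q).2%:~R | <= 1.

End Oracle.

(** * Model of computation: a random access machine over the integers, with
    oracle calls, under the logarithmic cost criterion. *)

(* The store is a family of integer arrays; a program names finitely many of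
   them, but their cells are addressed indirectly. *)
Definition store := nat -> int -> int.

Definition upd (s : store) (x : nat) (a z : int) : store :=
  fun y b => if (y == x) && (b == a) then z else s y b.

Definition bits (z : int) : nat := (trunc_log 2 `|z|).+1.

Inductive exp :=
| Cst of int
| Get of nat & exp
| Add of exp & exp
| Sub of exp & exp
| Mul of exp & exp
| Div of exp & exp.

Fixpoint eval (s : store) (e : exp) : int :=
  match e with
  | Cst z => z
  | Get x a => s x (eval s a)
  | Add a b => eval s a + eval s b
  | Sub a b => eval s a - eval s b
  | Mul a b => eval s a * eval s b
  | Div a b => (eval s a %/ eval s b)%Z
  end.

(* total length of all values (addresses included) met during evaluation *)
Fixpoint cost (s : store) (e : exp) : nat :=
  (bits (eval s e) +
   match e with
   | Cst _ => 0
   | Get _ a => cost s a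
   | Add a b | Sub a b | Mul a b | Div a b => cost s a + cost s b
   end)%N.

(* [Put x a e] is x[a] := e; [If e] and [While e] test 0 < e.
   [Ask i a b q k p x] queries the oracle for item i at phi = (a + b 'i) / q
   and frequency vector (k[0], ..., k[d-1]), with |p| digits of precision, and
   stores the answer in x[0] and x[1]. *)
Inductive cmd :=
| Skip
| Put of nat & exp & exp
| Seq of cmd & cmd
| If of exp & cmd & cmd
| While of exp & cmd
| Ask of exp & exp & exp & exp & nat & exp & nat.

Section Semantics.
Context {d : nat}.
Variable O : oracle d.

Definition mkquery (s : store) (i a b q : exp) (k : nat) (p : exp) : query d :=
  Query (eval s i) (eval s a) (eval s b) (eval s q)
        [ffun j : 'I_d => s k (j : nat)%:Z] `|eval s p|%N.

(* The precision is charged in unary. *)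
Definition ask_cost (s : store) (i a b q : exp) (k : nat) (p : exp) : nat :=
  let Q := mkquery s i a b q k p in
  (cost s i + cost s a + cost s b + cost s q + cost s p +
   \sum_(j < d) bits (qfreq Q j) + qprec Q +
   bits (O Q).1 + bits (O Q).2)%N.

(* [exec c s s' t]: started in store s, c halts in store s' at cost t. *)
Inductive exec : cmd -> store -> store -> nat -> Prop :=
| ExecSkip s : exec Skip s s 1
| ExecPut s x a e :
    exec (Put x a e) s (upd s x (eval s a) (eval s e)) (cost s a + cost s e)
| ExecSeq c1 c2 s s1 s2 t1 t2 :
    exec c1 s s1 t1 -> exec c2 s1 s2 t2 -> exec (Seq c1 c2) s s2 (t1 + t2)
| ExecIfTrue e c1 c2 s s' t :
    0 < eval s e -> exec c1 s s' t -> exec (If e c1 c2) s s' (cost s e + t)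
| ExecIfFalse e c1 c2 s s' t :
    eval s e <= 0 -> exec c2 s s' t -> exec (If e c1 c2) s s' (cost s e + t)
| ExecWhileTrue e c s s1 s2 t1 t2 :
    0 < eval s e -> exec c s s1 t1 -> exec (While e c) s1 s2 t2 ->
    exec (While e c) s s2 (cost s e + t1 + t2)
| ExecWhileFalse e c s :
    eval s e <= 0 -> exec (While e c) s s (cost s e)
| ExecAsk s i a b q k p x :
    exec (Ask i a b q k p x) s
      (upd (upd s x 0 (O (mkquery s i a b q k p)).1)
           x 1 (O (mkquery s i a b q k p)).2)
      (ask_cost s i a b q k p).

Lemma exec_det c s s1 t1 s2 t2 :
  exec c s s1 t1 -> exec c s s2 t2 -> s1 = s2 /\ t1 = t2.
Proof.
move=> h; elim: h s2 t2 => {c s s1 t1}; intros;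
  match goal with h : exec _ _ _ _ |- _ => inversion h; subst end;
  repeat match goal with
  | h : is_true (0 < ?e), h' : is_true (?e <= 0) |- _ =>
      by rewrite leNgt h in h'
  | IH : forall s2 t2, exec ?c ?s s2 t2 -> _, h : exec ?c ?s _ _ |- _ =>
      case: (IH _ _ h) => ? ?; subst; clear h
  end; by [].
Qed.

End Semantics.

(** * Input and output conventions *)

Section InputOutput.
Variable n : nat.
Implicit Types (v : 'I_n -> nat) (s : store).

(* Array 0 holds n in cell 0, array 1 the profits, every other cell is 0. *)
Definition input v : store := fun x a =>
  if (x == 0)%N && (a == 0) then n%:Z
  else if x == 1%N then
    if [pick i : 'I_n | a == (i : nat)%:Z] is Some i then (v i)%:Z else 0
  else 0.

Definition input_size v : nat := (n + \sum_(i < n) bits (v i)%:Z)%N.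

(* The selected items are the nonzero cells of array 2. *)
Definition output s : {set 'I_n} := [set i : 'I_n | s 2%N (i : nat)%:Z != 0].

End InputOutput.

(* Main.v *)
Require Import Defs.
From HB Require Import structures.
From mathcomp Require Import all_boot all_order all_algebra.
From mathcomp Require Import complex.
From mathcomp Require Import all_classical all_reals all_analysis.
From mathcomp Require Import measurable_realfun zify ring lra.

Set Implicit Arguments.
Unset Strict Implicit.
Unset Printing Implicit Defensive.

Import Order.TTheory GRing.Theory Num.Theory.
Import numFieldNormedType.Exports.

Local Open Scope classical_set_scope.
Local Open Scope ring_scope.

(* With phi = 1/A, the variables u_j = phi^(sum_(i in S) w_ij) lie in (0, 1], and
   the constraint sum_i w_ij <= 1 reads u_j >= 1/A. An integer polynomial q with
   values in [0, 1], close to 1 on u >= 1/A and close to 0 on u <= A^-(1 + eps),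
   makes E[prod_j q(u_j)] a proxy for the probability that S fits: up to a small
   error it lies between P(fits S 1) and P(fits S (1 + eps)). Expanded into
   monomials, it is a combination of constantly many terms
   prod_(i in S) E[phi^(k . w_i)] by independence. All the factors are in [0, 1],
   so such a product can be computed by rounding after each factor to a multiple
   of 1/M with M = O(n), the n rounding errors adding up to a constant. The
   vector of rounded products takes polynomially many values, and a dynamic
   program keeps a most profitable set for each of them. *)

(** * Execution cost of programs *)

(** The program must be fixed before the instance is known, so everything that it hard-codes may
    depend only on [d], [eps] and [gamma]: this is why [A], the number of monomials, their exponents
    and their integer coefficients come from an existence statement quantified before the
    probability space. The reals [gamma] and [eps] enter the machine only through two integers, in a
    test that compares a score times [D0] with a threshold [thr]. Additive errors suffice for a
    multiplicative guarantee because [gamma] is a constant: the proxy and the rounding each err by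
    at most [delta], and [delta] is taken as [eps * gamma / 8]. If [(1 - eps) * gamma <= 0], every
    set is good enough and the test is made trivial. Only probabilities and sizes are approximated.
    Profits stay exact, so the selected set earns at least the optimum. Running time is separated
    from behaviour: once every cell stays below [2 ^ h] and every loop runs at most [r] times, the
    cost is bounded by a syntactic function of the program, polynomial in [h] and [r]. *)

Fixpoint width (h : nat) (e : exp) : nat :=
  match e with
  | Cst z => bits z
  | Get _ _ => h
  | Add a b | Defs.Sub a b | Mul a b | Div a b => (width h a + width h b)%N
  end.

Fixpoint exp_bound (h : nat) (e : exp) : nat :=
  (width h e +
   match e with
   | Cst _ => 0
   | Get _ a => exp_bound h a
   | Add a b | Defs.Sub a b | Mul a b | Div a b => exp_bound h a + exp_bound h b
   end)%N.

(* [h] bounds the length of every cell of the store, and [r] the number of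
   iterations of every loop. *)
Fixpoint cmd_bound (d h r : nat) (c : cmd) : nat :=
  match c with
  | Skip => 1
  | Put _ a e => exp_bound h a + exp_bound h e
  | Seq c1 c2 => cmd_bound d h r c1 + cmd_bound d h r c2
  | If e c1 c2 => exp_bound h e + (cmd_bound d h r c1 + cmd_bound d h r c2)
  | While e c => r.+1 * (exp_bound h e + cmd_bound d h r c)
  | Ask i a b q _ p _ =>
      exp_bound h i + exp_bound h a + exp_bound h b + exp_bound h q +
      exp_bound h p + (d + 3) * h
  end%N.

Fixpoint writes (c : cmd) : seq nat :=
  match c with
  | Skip => [::]
  | Put x _ _ => [:: x]
  | Seq c1 c2 | If _ c1 c2 => writes c1 ++ writes c2
  | While _ c => writes c
  | Ask _ _ _ _ _ _ x => [:: x]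
  end.

(** A loop expanded when the program is written. It serves for the ranges [d] and [K], which are
    constants of the problem. *)
Fixpoint unroll (F : nat -> cmd) (m k : nat) : cmd :=
  if k is k'.+1 then Seq (F m) (unroll F m.+1 k') else Skip.

Lemma exec_writes d (O : oracle d) c s s' t :
  exec O c s s' t -> forall x, x \notin writes c -> s' x = s x.
Proof.
elim=> {c s s' t} //=.
- move=> s x a e y; rewrite inE => yx; apply/funext => b.
  by rewrite /upd (negbTE yx).
- move=> c1 c2 s s1 s2 t1 t2 _ IH1 _ IH2 x.
  by rewrite mem_cat negb_or => /andP[x1 x2]; rewrite IH2 // IH1.
- by move=> e c1 c2 s s' t _ _ IH x; rewrite mem_cat negb_or => /andP[x1 _]; exact: IH.
- by move=> e c1 c2 s s' t _ _ IH x; rewrite mem_cat negb_or => /andP[_ x2]; exact: IH.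
- by move=> e c s s1 s2 t1 t2 _ _ IH1 _ IH2 x xc; rewrite IH2 // IH1.
- move=> s i a b q k p x y; rewrite inE => yx; apply/funext => z.
  by rewrite /upd (negbTE yx).
Qed.

Lemma bits_le (z : int) m : (0 < m)%N -> (`|z| < 2 ^ m)%N -> (bits z <= m)%N.
Proof.
rewrite /bits; case: m => // m _; rewrite ltnS => zm.
case: (posnP `|z|%N) => [->|z0]; first by rewrite trunc_log0.
rewrite -ltnS -(ltn_exp2l _ _ (isT : 1 < 2)%N).
by apply: leq_ltn_trans zm; exact: trunc_logP.
Qed.

Lemma abs_lt_bits (z : int) : (`|z| < 2 ^ bits z)%N.
Proof. by rewrite /bits; exact: trunc_log_ltn. Qed.

(** * Total correctness with a cost bound *)

Section WeakestPrecondition.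
Variables (d : nat) (O : oracle d) (h r : nat).
Hypothesis h_gt0 : (0 < h)%N.

Definition bounded (s : store) := forall x a, (`|s x a| < 2 ^ h)%N.

(** Positive widths [u] and [w] give 2^u + 2^w <= 2^(u + w), which justifies adding widths in the
    case of sums and differences. *)
Lemma width_gt0 e : (0 < width h e)%N.
Proof. by elim: e => //= a IHa b IHb; rewrite addn_gt0 IHa. Qed.

Lemma eval_lt s e : bounded s -> (`|Defs.eval s e| < 2 ^ width h e)%N.
Proof.
move=> bs; elim: e => [z|x a _|a IHa b IHb|a IHa b IHb|a IHa b IHb|a IHa b IHb] //=.
- exact: abs_lt_bits.
- have Hs : (`|(Defs.eval s a + Defs.eval s b)%R| <= `|Defs.eval s a| + `|Defs.eval s b|)%N by lia.
  apply: leq_ltn_trans Hs _; rewrite expnD.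
  have := width_gt0 a; have := width_gt0 b.
  case: (width h a) IHa => // u; case: (width h b) IHb => // w; rewrite !expnS.
  have := expn_gt0 2 u; have := expn_gt0 2 w; nia.
- have Hs : (`|(Defs.eval s a - Defs.eval s b)%R| <= `|Defs.eval s a| + `|Defs.eval s b|)%N by lia.
  apply: leq_ltn_trans Hs _; rewrite expnD.
  have := width_gt0 a; have := width_gt0 b.
  case: (width h a) IHa => // u; case: (width h b) IHb => // w; rewrite !expnS.
  have := expn_gt0 2 u; have := expn_gt0 2 w; nia.
- by rewrite abszM expnD; apply: ltn_mul.
- have Hs : (`|(Defs.eval s a %/ Defs.eval s b)%Z| <= `|Defs.eval s a|)%N.
    exact: lez_div.
  apply: (leq_ltn_trans Hs); apply: (leq_trans IHa).
  by rewrite leq_exp2l // leq_addr.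
Qed.

Lemma cost_le s e : bounded s -> (cost s e <= exp_bound h e)%N.
Proof.
move=> bs; have H e' : (bits (Defs.eval s e') <= width h e')%N.
  by apply: bits_le; [exact: width_gt0|exact: eval_lt].
elim: e => [z|x a IHa|a IHa b IHb|a IHa b IHb|a IHa b IHb|a IHa b IHb] //=.
- by rewrite leq_add // (H (Get x a)).
- by rewrite leq_add ?(H (Add a b)) // leq_add.
- by rewrite leq_add ?(H (Defs.Sub a b)) // leq_add.
- by rewrite leq_add ?(H (Mul a b)) // leq_add.
- by rewrite leq_add ?(H (Div a b)) // leq_add.
Qed.

(** Termination, the cost bound and the preservation of small cells are built in, so that a proof
    about the final store also yields the running time. *)
Definition wp (c : cmd) (Q : store -> Prop) (s : store) : Prop :=
  exists s' t, [/\ exec O c s s' t, (t <= cmd_bound d h r c)%N,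
                   bounded s' & Q s'].

Lemma bounded_upd s x a z :
  bounded s -> (`|z| < 2 ^ h)%N -> bounded (upd s x a z).
Proof. by move=> bs zh y b; rewrite /upd; case: ifP. Qed.

(** Consequence and frame rule in one: the new postcondition may use that the arrays not written by
    [c] are unchanged. *)
Lemma wp_mono c (Q Q' : store -> Prop) s :
  (forall s', bounded s' -> (forall x, x \notin writes c -> s' x = s x) ->
     Q s' -> Q' s') ->
  wp c Q s -> wp c Q' s.
Proof.
move=> QQ [s' [t [e tb bs q]]]; exists s', t; split => //.
by apply: QQ => // x; exact: (exec_writes e).
Qed.

Lemma wp_skip (Q : store -> Prop) s : bounded s -> Q s -> wp Skip Q s.
Proof. by exists s, 1%N; split => //; constructor. Qed.

Lemma wp_put x a e (Q : store -> Prop) s :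
  bounded s -> (`|Defs.eval s e| < 2 ^ h)%N ->
  Q (upd s x (Defs.eval s a) (Defs.eval s e)) -> wp (Put x a e) Q s.
Proof.
move=> bs eh q; exists (upd s x (Defs.eval s a) (Defs.eval s e)), (cost s a + cost s e)%N.
split => //; [by constructor|by rewrite /= leq_add ?cost_le|exact: bounded_upd].
Qed.

Lemma wp_seq c1 c2 (Q : store -> Prop) s :
  wp c1 (fun s' => wp c2 Q s') s -> wp (Seq c1 c2) Q s.
Proof.
move=> [s1 [t1 [e1 b1 _ [s2 [t2 [e2 b2 bs2 q]]]]]].
exists s2, (t1 + t2)%N; split => //; last by rewrite /= leq_add.
exact: ExecSeq e1 e2.
Qed.

Lemma wp_if e c1 c2 (Q : store -> Prop) s :
  bounded s -> (0 < Defs.eval s e -> wp c1 Q s) -> (Defs.eval s e <= 0 -> wp c2 Q s) ->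
  wp (If e c1 c2) Q s.
Proof.
move=> bs H1 H2; case: (ltP 0 (Defs.eval s e)) => he.
- have [s1 [t1 [e1 b1 bs1 q]]] := H1 he.
  exists s1, (cost s e + t1)%N; split => //; first exact: ExecIfTrue.
  by rewrite /= leq_add ?cost_le // (leq_trans b1) // leq_addr.
- have [s1 [t1 [e1 b1 bs1 q]]] := H2 he.
  exists s1, (cost s e + t1)%N; split => //; first exact: ExecIfFalse.
  by rewrite /= leq_add ?cost_le // (leq_trans b1) // leq_addl.
Qed.

(** The invariant is indexed by the number of completed iterations, and the loop stops after exactly
    [N] of them, so the same index proves termination and bounds the cost. *)
Lemma wp_while (I : nat -> store -> Prop) N e c (Q : store -> Prop) s :
  (N <= r)%N -> bounded s -> I 0%N s ->
  (forall j s', (j < N)%N -> bounded s' -> I j s' ->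
     0 < Defs.eval s' e /\ wp c (I j.+1) s') ->
  (forall s', bounded s' -> I N s' -> Defs.eval s' e <= 0 /\ Q s') ->
  wp (While e c) Q s.
Proof.
move=> Nr bs I0 Istep Iend.
suff : forall k j s', (k + j = N)%N -> bounded s' -> I j s' ->
    exists s2 t, [/\ exec O (While e c) s' s2 t,
      (t <= k.+1 * (exp_bound h e + cmd_bound d h r c))%N, bounded s2 & Q s2].
  move=> /(_ N 0%N s (addn0 N) bs I0) [s2 [t [ex tb bs2 q]]].
  by exists s2, t; split => //=; rewrite (leq_trans tb) // leq_mul2r ltnS Nr orbT.
elim=> [|k IH] j s' kj bs' Ij.
  rewrite add0n in kj; rewrite kj in Ij.
  have [he q] := Iend _ bs' Ij.
  exists s', (cost s' e); split => //; first exact: ExecWhileFalse.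
  by rewrite mul1n (leq_trans (cost_le _ bs')) // leq_addr.
have [he [s1 [t1 [e1 b1 bs1 I1]]]] := Istep j s' ltac:(lia) bs' Ij.
have [s2 [t2 [e2 b2 bs2 q]]] := IH j.+1 s1 ltac:(lia) bs1 I1.
exists s2, (cost s' e + t1 + t2)%N; split => //.
  exact: ExecWhileTrue e1 e2.
by rewrite [(k.+2 * _)%N]mulSn leq_add // leq_add // cost_le.
Qed.

(** The precision is charged in unary, hence it must be at most [h] itself and not merely below
    [2 ^ h]. The term [(d + 3) * h] of the bound pays for the [d] frequencies, the precision and
    both parts of the answer. *)
Lemma wp_ask i a b q k p x (Q : store -> Prop) s :
  let A := O (mkquery s i a b q k p) in
  bounded s -> (`|Defs.eval s p| <= h)%N ->
  (`|A.1| < 2 ^ h)%N -> (`|A.2| < 2 ^ h)%N ->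
  Q (upd (upd s x 0 A.1) x 1 A.2) -> wp (Ask i a b q k p x) Q s.
Proof.
move=> A bs ph A1 A2 HQ.
exists (upd (upd s x 0 A.1) x 1 A.2), (ask_cost O s i a b q k p); split => //.
- by constructor.
- rewrite /ask_cost /=.
  have F : (\sum_(j < d) bits ([ffun j0 : 'I_d => s k (j0 : nat)%:Z] j) <= d * h)%N.
    rewrite -[X in (_ <= X * _)%N]card_ord -sum_nat_const; apply: leq_sum => j _.
    by rewrite ffunE; exact: bits_le.
  have B1 := bits_le h_gt0 A1; have B2 := bits_le h_gt0 A2.
  have := cost_le i bs; have := cost_le a bs; have := cost_le b bs.
  have := cost_le q bs; have := cost_le p bs.
  rewrite -/(mkquery s i a b q k p) -/A mulnDl; move: F B1 B2 ph; clear.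
  move: (bits _) (bits _) (\sum_(j < d) _)%N `|_|%N.
  by move: (cost s i) (cost s a) (cost s b) (cost s q) (cost s p) => *; lia.
- by do 2 apply: bounded_upd => //.
Qed.

Lemma wp_unroll (I : nat -> store -> Prop) F m k s :
  bounded s -> I m s ->
  (forall j s', (m <= j < m + k)%N -> bounded s' -> I j s' -> wp (F j) (I j.+1) s') ->
  wp (unroll F m k) (I (m + k)%N) s.
Proof.
elim: k m s => [|k IH] m s bs Im Istep /=; first by rewrite addn0; exact: wp_skip.
apply: wp_seq; have := Istep m s ltac:(lia) bs Im; apply: wp_mono => s' bs' _ Im'.
rewrite -addSnnS; apply: IH => // j s'' jm; apply: Istep; lia.
Qed.

End WeakestPrecondition.

(** * Polynomial growth of the cost bound *)

Definition polyb (f : nat -> nat) : Prop :=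
  exists p : {poly nat}, forall N, (f N <= p.[N])%N.

Lemma polyb_cst k : polyb (fun=> k).
Proof. by exists k%:P => N; rewrite hornerC. Qed.

Lemma polyb_id : polyb id.
Proof. by exists 'X => N; rewrite hornerX. Qed.

Lemma polybD f g : polyb f -> polyb g -> polyb (fun N => f N + g N)%N.
Proof.
by move=> [p pf] [q qg]; exists (p + q) => N; rewrite hornerD leq_add.
Qed.

Lemma polybM f g : polyb f -> polyb g -> polyb (fun N => f N * g N)%N.
Proof.
by move=> [p pf] [q qg]; exists (p * q) => N; rewrite hornerM leq_mul.
Qed.

Lemma polybX f k : polyb f -> polyb (fun N => f N ^ k)%N.
Proof.
move=> pf; elim: k => [|k IH]; first exact: (polyb_cst 1).
have [p pP] := polybM pf IH; exists p => N; rewrite expnS; exact: pP.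
Qed.

Lemma polyb_width (h : nat -> nat) e : polyb h -> polyb (fun N => width (h N) e).
Proof.
by move=> ph; elim: e => //= [z|a IHa b IHb|a IHa b IHb|a IHa b IHb|a IHa b IHb];
  [exact: polyb_cst|exact: polybD..].
Qed.

Lemma polyb_exp_bound (h : nat -> nat) e :
  polyb h -> polyb (fun N => exp_bound (h N) e).
Proof.
move=> ph; have W e' := polyb_width e' ph.
elim: e => [z|x a IHa|a IHa b IHb|a IHa b IHb|a IHa b IHb|a IHa b IHb] /=.
- exact: (polybD (W (Cst z)) (polyb_cst 0)).
- exact: (polybD (W (Get x a)) IHa).
- exact: (polybD (W (Add a b)) (polybD IHa IHb)).
- exact: (polybD (W (Add a b)) (polybD IHa IHb)).
- exact: (polybD (W (Add a b)) (polybD IHa IHb)).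
- exact: (polybD (W (Add a b)) (polybD IHa IHb)).
Qed.

Lemma polyb_cmd_bound d (h r : nat -> nat) c :
  polyb h -> polyb r -> polyb (fun N => cmd_bound d (h N) (r N) c).
Proof.
move=> ph pr; have E e := polyb_exp_bound e ph.
elim: c => [|x a e|c1 IH1 c2 IH2|e c1 IH1 c2 IH2|e c IH|i a b q k p x] /=.
- exact: polyb_cst.
- exact: polybD.
- exact: polybD.
- exact: (polybD (E e) (polybD IH1 IH2)).
- exact: (polybM (polybD (polyb_cst 1) pr) (polybD (E e) IH)).
- by repeat apply: polybD => //; apply: polybM => //; exact: polyb_cst.
Qed.

(** * Dynamic programming *)

Section Digits.
Variable B : nat.
Hypothesis B_gt0 : (0 < B)%N.

Lemma digits_lt (y : nat -> nat) K :
  (forall k, (k < K)%N -> (y k < B)%N) -> (\sum_(k < K) y k * B ^ k < B ^ K)%N.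
Proof.
elim: K => [|K IH] yB; first by rewrite big_ord0.
rewrite big_ord_recr /= expnS.
have : ((y K).+1 * B ^ K <= B * B ^ K)%N by rewrite leq_mul2r yB ?orbT.
rewrite mulSn => /(leq_trans _); apply.
by rewrite ltn_add2r; apply: IH => k kK; apply: yB; exact: leqW.
Qed.

(** [H] is whatever is stored above the [K] packed digits; it will be 0 for nodes and the profit for
    table entries. *)
Lemma digits_nth (y : nat -> nat) K H k :
  (k < K)%N -> (forall k, (k < K)%N -> (y k < B)%N) ->
  ((H * B ^ K + \sum_(k < K) y k * B ^ k) %/ B ^ k %% B = y k)%N.
Proof.
elim: K H k => [//|K IH] H k kK yB.
rewrite big_ord_recr /= addnCA expnS.
have -> : (\sum_(i < K) y i * B ^ i + (H * (B * B ^ K) + y K * B ^ K) =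
           (H * B + y K) * B ^ K + \sum_(i < K) y i * B ^ i)%N by ring.
move: kK; rewrite ltnS leq_eqVlt => /orP[/eqP ->|kK].
  rewrite divnMDl ?expn_gt0 ?B_gt0 // divn_small ?addn0; last first.
    by apply: digits_lt => i iK; apply: yB; exact: leqW.
  by rewrite modnMDl modn_small // yB.
by apply: IH => // i iK; apply: yB; exact: leqW.
Qed.

End Digits.

(* A longest-path computation on the layered graph whose layer i consists of
   the nodes i * L + s with s < L: an item is skipped along the edge to
   i.+1 * L + s, taken along the edge to i.+1 * L + tr i s. *)
Section LayeredPaths.
Variables (L start : nat) (tr : nat -> nat -> nat) (W : nat -> nat).
Hypotheses (start_lt : (start < L)%N) (tr_lt : forall i s, (s < L)%N -> (tr i s < L)%N).

Definition set_max (T : nat -> nat) a e := fun b => if b == a then maxn (T a) e else T b.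

Lemma set_maxE T b e a :
  set_max T b e a = if a == b then maxn (T b) e else T a.
Proof. by []. Qed.

(** Values are pushed forward along the two edges leaving [j]. Both lead to larger indices, so the
    entry of [j] is final when it is read. *)
Definition relax (T : nat -> nat) j : nat -> nat :=
  if (0 < T j)%N then
    let T1 := set_max T (j + L) (T j) in
    set_max T1 ((j %/ L).+1 * L + tr (j %/ L) (j %% L))%N (T1 j + W (j %/ L))%N
  else T.

Fixpoint table j : nat -> nat :=
  if j is j'.+1 then relax (table j') j' else fun a => (a == start : nat).

Fixpoint node (X : pred nat) i : nat :=
  if i is i'.+1 then if X i' then tr i' (node X i') else node X i' else start.

(* The leading 1 tells reachable nodes from the others, whose entry is 0. *)
Definition weight (X : pred nat) i : nat := (1 + \sum_(l < i | X l) W l)%N.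

Lemma node_lt X i : (node X i < L)%N.
Proof. by elim: i => //= i IH; case: ifP => // _; exact: tr_lt. Qed.

Lemma eq_node X Y i : (forall l, (l < i)%N -> X l = Y l) -> node X i = node Y i.
Proof.
elim: i => //= i IH XY; rewrite XY // IH // => l li; apply: XY; exact: leqW.
Qed.

Lemma weightS X i : weight X i.+1 = (weight X i + X i * W i)%N.
Proof.
rewrite /weight big_mkcond big_ord_recr -big_mkcond /= addnA.
by case: (X i); rewrite ?mul1n ?mul0n.
Qed.

Lemma eq_weight X Y i : (forall l, (l < i)%N -> X l = Y l) -> weight X i = weight Y i.
Proof. by move=> XY; congr addn; apply: eq_bigl => l; exact: XY. Qed.

Let L_gt0 : (0 < L)%N. Proof. exact: leq_ltn_trans start_lt. Qed.

Lemma table_sound j a : (0 < table j a)%N ->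
  exists X, a = (a %/ L * L + node X (a %/ L))%N /\ table j a = weight X (a %/ L).
Proof.
have layer i s : (s < L)%N -> ((i * L + s) %/ L = i)%N.
  by move=> sL; rewrite divnMDl // divn_small // addn0.
elim: j a => [|j IH] a /=.
  case: eqP => // -> _; exists pred0.
  by rewrite divn_small //= /weight big_ord0 mul0n.
rewrite /relax; case: ifP => [Tj|_]; last exact: IH.
have [X [jE Xw]] := IH j Tj; set i := (j %/ L)%N in jE Xw *.
have jm : (j %% L = node X i)%N by rewrite jE modnMDl modn_small // node_lt.
have jL : (j == j + L)%N = false by apply/eqP; lia.
have skip b : (0 < set_max (table j) (j + L) (table j j) b)%N ->
    exists Y, b = (b %/ L * L + node Y (b %/ L))%N /\
      set_max (table j) (j + L) (table j j) b = weight Y (b %/ L).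
  rewrite /set_max; case: eqP => [->|_]; last exact: IH.
  case: (leqP (table j j) (table j (j + L))) => [h|h].
    exact: IH.
  (* The entry of [j] determines [X] only below layer [i]; cutting [X] there leaves the choice about
     item [i] free. *)
  move=> _; exists (fun l => (l < i)%N && X l).
  have XY l : (l < i)%N -> ((l < i)%N && X l) = X l by move=> ->.
  have -> : ((j + L) %/ L = i.+1)%N by rewrite divnDr // divnn L_gt0 addn1.
  rewrite weightS /= ltnn /= mul0n addn0 (eq_node XY) (eq_weight XY); split => //.
  by rewrite mulSn; lia.
set T1 := set_max _ _ _ in skip *; rewrite set_maxE; case: eqP => [->|_]; last exact: skip.
rewrite layer; last by apply: tr_lt; rewrite ltn_mod.
set a' := (_ + tr _ _)%N; have -> : T1 j = table j j by rewrite /T1 set_maxE jL.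
case: (leqP (table j j + W i)%N (T1 a')) => [h|h].
  move=> /skip; rewrite /a' layer //.
  by apply: tr_lt; rewrite ltn_mod.
move=> _; exists (fun l => (l < i)%N && X l || (l == i)).
have XY l : (l < i)%N -> ((l < i)%N && X l || (l == i)) = X l.
  by move=> li; rewrite li (ltn_eqF li) orbF.
rewrite weightS /= ltnn eqxx /= mul1n (eq_node XY) (eq_weight XY) -Xw; split => //.
by rewrite /a' -jm.
Qed.

Lemma table_mono j a : (table j a <= table j.+1 a)%N.
Proof.
rewrite /= /relax; case: ifP => // _; rewrite /set_max.
by repeat case: eqP => [->|_] //; rewrite ?leq_max ?leqnn ?orbT //;
  repeat case: eqP => // _; rewrite ?leq_max ?leqnn ?orbT.
Qed.

(** The condition says that the predecessor on the path of [X] has already been relaxed. Layer 0 has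
    no predecessor, whence the first alternative. *)
Lemma table_complete j X i : (i == 0%N) || (i.-1 * L + node X i.-1 < j)%N ->
  (weight X i <= table j (i * L + node X i))%N.
Proof.
elim: j X i => [|j IH] X i; rewrite ?orbF.
  by case: i => //= _; rewrite /weight big_ord0 mul0n eqxx.
case: i => [|i] /=; first by move=> _; apply: leq_trans (table_mono _ _); exact: IH.
rewrite ltnS leq_eqVlt => /orP[/eqP jE|ij]; last first.
  by apply: leq_trans (table_mono _ _); exact: (IH _ i.+1).
have jd : (j %/ L = i)%N by rewrite -jE divnMDl // divn_small ?addn0 // node_lt.
have jm : (j %% L = node X i)%N by rewrite -jE modnMDl modn_small // node_lt.
have Tj : (weight X i <= table j j)%N.
  rewrite -{2}jE; apply: IH; case: i jE {jd jm} => // i /= <-.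
  by have := node_lt X i; rewrite mulSn; move: (node _ _) (tr _ _) => *; lia.
have jL : (j == j + L)%N = false by apply/eqP; lia.
rewrite weightS /relax (leq_trans _ Tj) ?jd ?jm; last by rewrite /weight.
rewrite /set_max jL; case: (X i).
  by rewrite eqxx mul1n leq_max leq_add2r Tj orbT.
rewrite mul0n addn0.
have -> : (i.+1 * L + node X i = j + L)%N by rewrite -jE mulSn; lia.
(* Both edges may end in the same node; a second maximum does not lower the entry. *)
by rewrite eqxx; case: eqP => [<-|_]; rewrite ?eqxx !leq_max Tj ?orbT.
Qed.

(** An entry is the weight of an actual set, hence at most that of all items. This keeps the table
    within the cell size. *)
Lemma table_le j a : (table j a <= weight xpredT (a %/ L))%N.
Proof.
case: (posnP (table j a)) => [->//|/table_sound[X [_ ->]]].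
by rewrite leq_add2l big_mkcond leq_sum // => l _; case: ifP.
Qed.

End LayeredPaths.

Fixpoint scan (acc : pred nat) (F : nat -> nat) (m k : nat) : nat :=
  if k is k'.+1 then
    let b := scan acc F m k' in if acc (m + k')%N then maxn b (F (m + k')%N) else b
  else 0%N.

Lemma scan_sound (acc : pred nat) F m k : (0 < scan acc F m k)%N ->
  exists j, [/\ (m <= j < m + k)%N, acc j & scan acc F m k = F j].
Proof.
elim: k => //= k IH; case: ifP => [ak|_].
  case: (leqP (F (m + k)%N) (scan acc F m k)) => [_ /IH[j [jm aj ->]]|_ _].
    by exists j; split=> //; lia.
  by exists (m + k)%N; split => //; lia.
by move=> /IH[j [jm aj ->]]; exists j; split=> //; lia.
Qed.

Lemma scan_complete (acc : pred nat) F m k j :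
  (m <= j < m + k)%N -> acc j -> (F j <= scan acc F m k)%N.
Proof.
elim: k => /= [|k IH] jm aj; first lia.
case: (eqVneq j (m + k)%N) => [->{jm}|jk] in aj *.
  by rewrite aj leq_maxr.
have {}IH := IH ltac:(lia) aj.
by case: ifP => // _; rewrite leq_max IH.
Qed.

(** * Means of products of independent variables *)

Section BoundedExpectation.
Context {R : realType} {disp : measure_display} {T : measurableType disp}.
Variable P : probability T R.

Definition mbounded (f : T -> R) : Prop :=
  measurable_fun setT f /\ exists M : R, forall t, `|f t| <= M.

Lemma mbounded_integrable f : mbounded f -> P.-integrable setT (EFin \o f).
Proof.
move=> [mf [M fM]]; apply: measurable_bounded_integrable => //.
  by rewrite (le_lt_trans (probability_le1 _ _)) // ltry.
exists M; split; first exact: num_real.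
by move=> x Mx t _ /=; rewrite (le_trans (fM t)) // ltW.
Qed.

Lemma mbounded_cst (c : R) : mbounded (fun=> c).
Proof. by split; [exact: measurable_cst|exists `|c|]. Qed.

Lemma mboundedD f g : mbounded f -> mbounded g -> mbounded (fun t => f t + g t).
Proof.
move=> [mf [M fM]] [mg [N gN]]; split; first exact: measurable_funD.
by exists (M + N) => t; rewrite (le_trans (ler_normD _ _)) // lerD.
Qed.

Lemma mboundedM f g : mbounded f -> mbounded g -> mbounded (fun t => f t * g t).
Proof.
move=> [mf [M fM]] [mg [N gN]]; split; first exact: measurable_funM.
by exists (M * N) => t; rewrite normrM ler_pM.
Qed.

Lemma mbounded_sum (I : Type) (r : seq I) (p : pred I) (F : I -> T -> R) :
  (forall i, p i -> mbounded (F i)) -> mbounded (fun t => \sum_(i <- r | p i) F i t).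
Proof.
move=> bF; elim: r => [|i r IH].
  by under eq_fun do rewrite big_nil; exact: mbounded_cst.
case pi: (p i); under eq_fun do rewrite big_cons pi; last exact: IH.
by apply: mboundedD => //; exact: bF.
Qed.

Lemma mbounded_prod (I : Type) (r : seq I) (p : pred I) (F : I -> T -> R) :
  (forall i, p i -> mbounded (F i)) -> mbounded (fun t => \prod_(i <- r | p i) F i t).
Proof.
move=> bF; elim: r => [|i r IH].
  by under eq_fun do rewrite big_nil; exact: mbounded_cst.
case pi: (p i); under eq_fun do rewrite big_cons pi; last exact: IH.
by apply: mboundedM => //; exact: bF.
Qed.

Lemma mbounded_indic (A : set T) : measurable A -> mbounded (\1_A : T -> R).
Proof.
move=> mA; split; first exact: measurable_indic.
by exists 1 => t; rewrite indicE; case: (_ \in _); rewrite /= ?normr1 ?normr0.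
Qed.

Definition mean (f : T -> R) : R := fine 'E_P[f].

Lemma meanE f : mean f = \int[P]_(t in setT) f t.
Proof. by rewrite /mean unlock. Qed.

Lemma meanD f g : mbounded f -> mbounded g ->
  mean (fun t => f t + g t) = mean f + mean g.
Proof.
by move=> bf bg; rewrite !meanE RintegralD //; exact: mbounded_integrable.
Qed.

Lemma meanZ c f : mbounded f -> mean (fun t => c * f t) = c * mean f.
Proof. by move=> bf; rewrite !meanE RintegralZl //; exact: mbounded_integrable. Qed.

Lemma mean_cst c : mean (fun=> c) = c.
Proof.
by rewrite meanE Rintegral_cst //= probability_setT mulr1.
Qed.

Lemma mean_sum (I : Type) (r : seq I) (p : pred I) (F : I -> T -> R) :
  (forall i, mbounded (F i)) ->
  mean (fun t => \sum_(i <- r | p i) F i t) = \sum_(i <- r | p i) mean (F i).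
Proof.
move=> bF; elim: r => [|i r IH].
  by rewrite big_nil; under eq_fun do rewrite big_nil; exact: mean_cst.
rewrite big_cons; case pi: (p i); under eq_fun do rewrite big_cons pi; last exact: IH.
by rewrite -IH -meanD //; exact: mbounded_sum.
Qed.

Lemma mean_indic (A : set T) : measurable A -> mean (\1_A) = fine (P A).
Proof. by move=> mA; rewrite /mean expectation_indic. Qed.

Lemma le_mean f g : mbounded f -> mbounded g -> (forall t, f t <= g t) ->
  mean f <= mean g.
Proof.
move=> bf bg fg; rewrite !meanE; apply: le_Rintegral => //; exact: mbounded_integrable.
Qed.

Lemma dist_mean f g e : mbounded f -> mbounded g ->
  (forall t, `|f t - g t| <= e) -> `|mean f - mean g| <= e.
Proof.
move=> bf bg fg; have be := mbounded_cst e.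
rewrite ler_distl; apply/andP; split.
  rewrite lerBlDr -[e in X in _ <= X]mean_cst -meanD //.
  apply: le_mean => //; first exact: mboundedD.
  by move=> t; have := fg t; rewrite ler_distl => /andP[]; rewrite lerBlDr.
rewrite -[e in X in _ <= X]mean_cst -meanD //.
apply: le_mean => //; first exact: mboundedD.
by move=> t; have := fg t; rewrite ler_distl => /andP[].
Qed.

End BoundedExpectation.

(** Telescoping: the factors are exchanged one at a time, and as the others are at most 1, each
    exchange costs at most [e]. *)
Lemma dist_prod_le (R : realType) (I : Type) (r : seq I) (p : pred I) (a b : I -> R) (e : R) :
  (forall i, 0 <= a i <= 1) -> (forall i, 0 <= b i <= 1) ->
  (forall i, `|a i - b i| <= e) ->
  `|\prod_(i <- r | p i) a i - \prod_(i <- r | p i) b i| <= (size r)%:R * e.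
Proof.
move=> a01 b01 ab.
have prod01 (c : I -> R) s : (forall i, 0 <= c i <= 1) ->
    0 <= \prod_(i <- s | p i) c i <= 1.
  move=> c01; rewrite prodr_ge0 /=; last by move=> i _; case/andP: (c01 i).
  by apply: prodr_ile1 => i.
elim: r => [|i r IH]; first by rewrite !big_nil subrr normr0 mul0r.
have e0 : 0 <= e := le_trans (normr_ge0 _) (ab i).
rewrite !big_cons /= -natr1 mulrDl mul1r; case: ifP => _; last first.
  by rewrite (le_trans IH) // lerDl.
set x := \prod_(_ <- _ | _) _ in IH *; set y := \prod_(_ <- _ | _) _ in IH *.
have -> : a i * x - b i * y = a i * (x - y) + (a i - b i) * y by ring.
have /andP[y0 y1] : 0 <= y <= 1 := prod01 b r b01.
have /andP[ai0 ai1] := a01 i.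
rewrite (le_trans (ler_normD _ _)) // lerD // normrM.
- by rewrite (le_trans _ IH) // ger0_norm // ler_piMl.
- by rewrite (le_trans _ (ab i)) // (ger0_norm y0) ler_piMr.
Qed.

Section Independence.
Context {R : realType} {disp : measure_display} {T : measurableType disp}.
Variables (P : probability T R) (n d : nat) (w : 'I_n -> 'I_d -> {RV P >-> R}).
Hypothesis indep : mutually_independent w.

Let sigma i : set (set T) := g_sigma_preimage (fun j : 'I_d => w i j : T -> R).

Lemma g_sigma_preimage_measurable i A : sigma i A -> measurable A.
Proof.
apply: smallest_sub; first exact: sigma_algebra_measurable.
elim/big_ind: _ => //; first by move=> x y xm ym z [/xm|/ym].
by move=> j _ _ [B mB <-]; apply: measurable_funPT.
Qed.

(* A function with values in [0, 1] is a uniform limit of these averages of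
   indicators, which reduces the product rule for means to that for events. *)
Let stair (N : nat) (f : T -> R) (l : 'I_N) : T -> R :=
  \1_[set t | l.+1%:R <= N%:R * f t].
Let stairs N f t : R := N%:R^-1 * \sum_(l < N) stair f l t.

(** The sum counts the integers from 1 to [N] that are at most [N%:R * f t], so [stairs N f t] is
    the integer part of [N%:R * f t] divided by [N]. *)
Lemma stairs_approx (N : nat) (f : T -> R) t : (0 < N)%N -> 0 <= f t <= 1 ->
  0 <= stairs N f t <= 1 /\ `|f t - stairs N f t| <= N%:R^-1.
Proof.
move=> N0 /andP[f0 f1]; rewrite /stairs.
have N0' : 0 < N%:R :> R by rewrite ltr0n.
have {f0}y0 : 0 <= N%:R * f t by rewrite mulr_ge0 // ltW.
have {f1}yN : N%:R * f t <= N%:R by rewrite ler_piMr // ltW.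
suff [m [mN -> my ym]] : exists m : nat, [/\ (m <= N)%N,
    \sum_(l < N) stair f l t = m%:R, m%:R <= N%:R * f t & N%:R * f t <= m.+1%:R].
  have -> : f t - N%:R^-1 * m%:R = N%:R^-1 * (N%:R * f t - m%:R).
    by field; rewrite gt_eqF.
  rewrite normrM gtr0_norm ?invr_gt0 // ler_piMr ?invr_ge0 ?(ltW N0') //; last first.
    by rewrite ger0_norm ?subr_ge0 // lerBlDr -natr1 addrC in ym *.
  by rewrite mulr_ge0 ?invr_ge0 ?ler0n //= [X in X <= _]mulrC ler_pdivrMr // mul1r ler_nat.
rewrite /stair; set y := N%:R * f t in y0 yN *.
have E l : \1_[set t | l.+1%:R <= N%:R * f t] t = (l.+1%:R <= y)%R%:R :> R.
  by rewrite indicE; congr (nat_of_bool _)%:R; apply/idP/idP; rewrite inE.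
(* The induction passes through prefixes shorter than [y], in which every integer counts; the
   alternative [m = N] covers them. *)
suff [m [mN sE my ym]] : exists m : nat, [/\ (m <= N)%N,
    \sum_(l < N) (l.+1%:R <= y)%R%:R = m%:R :> R, m%:R <= y & (y < m.+1%:R) \/ m = N].
  exists m; split => //; first by rewrite -sE; apply: eq_bigr => l _; exact: E.
  by case: ym => [/ltW//|->]; rewrite (le_trans yN) // ler_nat.
elim: (N) => [|k [m [mk sE my ym]]]; first by exists 0%N; rewrite big_ord0; split => //; right.
rewrite big_ord_recr /= sE; case: (leP k.+1%:R y) => ky.
  exists k.+1; split => //; last by right.
  case: ym => [ym|->]; last by rewrite natr1.
  by have := le_lt_trans ky ym; rewrite ltr_nat ltnS ltnNge mk.
exists m; split => //; [exact: leqW|by rewrite addr0|left].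
by case: ym => // ->.
Qed.

(** For staircases, expanding the product leaves indicators of intersections, one level set per
    item, to which independence applies. Replacing each variable by its staircase changes either
    side by as little as desired. *)
Lemma mean_prod_indep (S : {set 'I_n}) (Y : 'I_n -> T -> R) :
  (forall i t, 0 <= Y i t <= 1) ->
  (forall i (B : set R), measurable B -> sigma i (Y i @^-1` B)) ->
  mean P (fun t => \prod_(i in S) Y i t) = \prod_(i in S) mean P (Y i).
Proof.
move=> Y01 sY.
have bY i : mbounded (Y i).
  split; last by exists 1 => t; case/andP: (Y01 i t) => ? ?; rewrite ger0_norm.
  by move=> _ B mB; rewrite setTI; apply: (@g_sigma_preimage_measurable i); exact: sY.
have sst N i (l : 'I_N) : sigma i [set t | l.+1%:R <= N%:R * Y i t].
  have mh : measurable_fun [set: R] (fun x : R => N%:R * x).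
    by apply: measurable_funM => //; exact: measurable_cst.
  have := mh measurableT _ (measurable_itv `[l.+1%:R, +oo[).
  rewrite setTI => /(sY i); congr (g_sigma_preimage _ _); apply/funext => t /=.
  by rewrite in_itv /= andbT.
have mst N i l := @g_sigma_preimage_measurable i _ (@sst N i l).
have bst N i (l : 'I_N) : mbounded (stair (Y i) l) by exact: mbounded_indic.
have bs N i : mbounded (stairs N (Y i)).
  by apply: mboundedM; [exact: mbounded_cst|exact: mbounded_sum].
have Estairs N : (0 < N)%N -> mean P (fun t => \prod_(i in S) stairs N (Y i) t) =
                 \prod_(i in S) mean P (stairs N (Y i)).
  move=> N0; pose j0 := Ordinal N0.
  have -> : (fun t => \prod_(i in S) stairs N (Y i) t) = (fun t =>
      \sum_(f in pfamily j0 (mem S) (fun=> predT))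
        (\prod_(i in S) N%:R^-1) *
        \1_(\bigcap_(i in [set` S]) [set t | (f i).+1%:R <= N%:R * Y i t]) t).
    apply/funext => t; under eq_bigr do rewrite /stairs mulr_sumr.
    rewrite (big_distr_big j0); apply: eq_bigr => f _.
    rewrite big_split /=; congr (_ * _); rewrite indicE.
    set A := \bigcap_(_ in _) _; have [h|h] := pselect (A t).
      rewrite (mem_set h); apply: big1 => i iS; rewrite /stair indicE mem_set //; exact: h.
    rewrite (memNset h).
    move/existsNP: h => [i /not_implyP [/= iS h]].
    by rewrite (bigD1 i) //= /stair indicE memNset // mul0r.
  rewrite mean_sum; last first.
    move=> f; apply: mboundedM; first exact: mbounded_cst.
    apply: mbounded_indic; apply: fin_bigcap_measurable => // i _; exact: mst.
  have -> : \prod_(i in S) mean P (stairs N (Y i)) = \prod_(i in S)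
      \sum_(l < N) N%:R^-1 * fine (P [set t | l.+1%:R <= N%:R * Y i t]).
    apply: eq_bigr => i _; rewrite /stairs meanZ; last exact: mbounded_sum.
    by rewrite mean_sum // mulr_sumr; apply: eq_bigr => l _; rewrite mean_indic.
  rewrite (big_distr_big j0); apply: eq_bigr => f _.
  have mI : measurable (\bigcap_(i in [set` S]) [set t | (f i).+1%:R <= N%:R * Y i t]).
    by apply: fin_bigcap_measurable => // i _; exact: mst.
  rewrite meanZ; last exact: mbounded_indic.
  rewrite mean_indic // big_split /= indep; last by move=> i _; exact: sst.
  congr (_ * _); apply: EFin_inj; rewrite -prodEFin fineK.
    by apply: eq_bigr => i _; rewrite fineK // fin_num_measure.
  rewrite -indep; last by move=> i _; exact: sst.
  by rewrite fin_num_measure.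
apply/eqP; rewrite -subr_eq0 -normr_le0; apply/ler_addgt0Pr => e e0.
rewrite add0r.
(* Either side moves by at most n / N, by [dist_prod_le], and the two together by at most [e]. *)
pose N := (Num.truncn ((2 * (size (index_enum 'I_n))%:R) / e)).+1.
have N0 : 0 < N%:R :> R by rewrite ltr0n.
have Ne : 2 * ((size (index_enum 'I_n))%:R * N%:R^-1) <= e.
  rewrite mulrA ler_pdivrMr // [e * _]mulrC -ler_pdivrMr //.
  exact/ltW/truncnS_gt.
apply: le_trans Ne.
have st01 i t := (stairs_approx (isT : (0 < N)%N) (Y01 i t)).1.
have stY i t := (stairs_approx (isT : (0 < N)%N) (Y01 i t)).2.
have m01 (f : T -> R) : mbounded f -> (forall t, 0 <= f t <= 1) -> 0 <= mean P f <= 1.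
  move=> bf f01; apply/andP; split; [rewrite -(mean_cst P 0)|rewrite -(mean_cst P 1)];
    by apply: le_mean => // [|t]; [exact: mbounded_cst|case/andP: (f01 t)].
rewrite mulr_natl -(subrKA (mean P (fun t => \prod_(i in S) stairs N (Y i) t))).
rewrite (le_trans (ler_normD _ _)) // lerD //.
  apply: dist_mean; [exact: mbounded_prod|exact: mbounded_prod|move=> t].
  exact: dist_prod_le.
rewrite Estairs // distrC; apply: dist_prod_le => i; [exact: m01|exact: m01|].
by apply: dist_mean.
Qed.

End Independence.

(** * The Laplace transform proxy *)

Lemma bernoulli_ge (R : realDomainType) (x : R) n : -1 <= x -> 1 + n%:R * x <= (1 + x) ^+ n.
Proof.
move=> x1; elim: n => [|n IH]; first by rewrite mul0r addr0 expr0.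
have x10 : 0 <= 1 + x by rewrite -lerBlDl sub0r.
rewrite exprS; apply: le_trans (ler_wpM2l x10 IH).
have : 0 <= n%:R * x ^+ 2 by rewrite mulr_ge0 // sqr_ge0.
rewrite -natr1; nra.
Qed.

(** Multiply by (1 + y)^n: the left side becomes (1 - y^2)^n <= 1, while (1 + y)^n >= n y by
    Bernoulli. *)
Lemma bernoulli_le (R : realFieldType) (y : R) n : 0 < y <= 1 -> (0 < n)%N ->
  (1 - y) ^+ n <= (n%:R * y)^-1.
Proof.
move=> /andP[y0 y1] n0; have n0' : 0 < n%:R :> R by rewrite ltr0n.
rewrite -[_^-1]mul1r ler_pdivlMr ?mulr_gt0 //.
apply: (@le_trans _ _ ((1 - y) ^+ n * (1 + y) ^+ n)).
  rewrite ler_wpM2l // ?exprn_ge0 ?subr_ge0 //.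
  by apply: le_trans (@bernoulli_ge _ y n _); rewrite ?lerDr // ltW // (lt_trans _ y0) // ltrN10.
by rewrite -exprMn -subr_sqr expr1n exprn_ile1 ?subr_ge0 ?expr_le1 ?gerBl ?sqr_ge0 // ltW.
Qed.

(* The Stone-Weierstrass kernel 1 - (1 - u^m)^(2A)^m: at u >= 1/A and at
   u <= 1/(4A) the factor (2A u)^m is at least 2^m, resp. at most 2^-m. *)
Lemma step_polynomial (R : archiRealFieldType) (A : nat) (delta : R) :
  (0 < A)%N -> 0 < delta ->
  exists q : {poly int}, forall u : R, 0 < u <= 1 ->
    let qu := (map_poly intr q).[u] in
    [/\ 0 <= qu <= 1, A%:R^-1 <= u -> 1 - delta <= qu
      & u <= (4 * A)%:R^-1 -> qu <= delta].
Proof.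
move=> A0 d0.
have A0' : 0 < A%:R :> R by rewrite ltr0n.
(* [m] exceeds 1/delta and 2^m exceeds [m], so 2^-m is at most [delta]. *)
pose m := (Num.truncn delta^-1).+1.
have dm : 2^-1 ^+ m <= delta.
  rewrite exprVn -[delta]invrK lef_pV2 ?posrE ?exprn_gt0 ?invr_gt0 //.
  apply: le_trans (ltW (truncnS_gt _)) _.
  by rewrite -natrX ler_nat ltnW // ltn_expl.
pose N := ((2 * A) ^ m)%N.
have N0 : (0 < N)%N by rewrite expn_gt0 muln_gt0 A0.
exists (1 - (1 - 'X^m) ^+ N) => u /andP[u0 u1] /=.
rewrite rmorphB rmorphXn rmorphB rmorph1 /= map_polyXn.
rewrite hornerD hornerN horner_exp !hornerE.
have um0 : 0 < u ^+ m by rewrite exprn_gt0.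
have um1 : u ^+ m <= 1 by rewrite exprn_ile1 // ltW.
have y0 : 0 <= (1 - u ^+ m) ^+ N by rewrite exprn_ge0 // subr_ge0.
split.
- rewrite subr_ge0 gerBl y0 andbT exprn_ile1 ?subr_ge0 ?gerBl //; exact: ltW.
- move=> Au; rewrite lerD2l lerN2 (le_trans _ dm) //.
  apply: (le_trans (bernoulli_le _ N0)); first by rewrite um0.
  rewrite exprVn lef_pV2 ?posrE ?mulr_gt0 ?exprn_gt0 ?ltr0n //.
  rewrite /N natrX -exprMn lerXn2r ?nnegrE ?mulr_ge0 ?ler0n ?(ltW u0) //.
  by rewrite natrM -mulrA ler_peMr // -ler_pdivrMl // mulr1.
- move=> uA; rewrite (le_trans _ dm) // lerBlDr -lerBlDl.
  apply: le_trans (@bernoulli_ge _ (- u ^+ m) N _); last by rewrite lerN2.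
  rewrite mulrN lerD2l lerN2 /N natrX -exprMn.
  rewrite lerXn2r ?nnegrE ?mulr_ge0 ?invr_ge0 ?ler0n ?(ltW u0) //.
  apply: le_trans (ler_wpM2l _ uA) _ => //.
  suff -> : (2 * A)%:R * (4 * A)%:R^-1 = 2^-1 :> R by [].
  by rewrite !natrM; field; rewrite gt_eqF.
Qed.

(** The inequality amounts to A^eps >= 4, so any [A] above 4^(1/eps) will do. It turns the slack
    [eps] in the size into the factor 4 that separates the two sides of the step polynomial. *)
Lemma base_exists (R : realType) (eps : R) : 0 < eps ->
  exists2 A : nat, (0 < A)%N & A%:R^-1 `^ (1 + eps) <= (4 * A)%:R^-1.
Proof.
move=> e0; exists (Num.truncn (4 `^ eps^-1 : R)).+1 => //.
set A := _.+1; have A0 : 0 < A%:R :> R by rewrite ltr0n.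
have A0' : A%:R^-1 != 0 :> R by rewrite gt_eqF ?invr_gt0.
rewrite powRD ?A0' ?implybT // powRr1 ?invr_ge0 ?ler0n //.
rewrite natrM invfM mulrC ler_pM2r ?invr_gt0 // -powR_inv1 ?ler0n //.
rewrite -powRrM mulN1r powRN lef_pV2 ?posrE ?powR_gt0 //.
have -> : 4 = (4 `^ eps^-1) `^ eps :> R.
  by rewrite -powRrM mulVf ?gt_eqF // powRr1.
rewrite ge0_ler_powR ?nnegrE ?powR_ge0 ?ler0n ?(ltW e0) //.
exact/ltW/truncnS_gt.
Qed.

Section Sandwich.
Context {R : realType} {disp : measure_display} {T : measurableType disp}.
Variables (P : probability T R) (n d : nat) (w : 'I_n -> 'I_d -> {RV P >-> R}).
Variables (A : nat) (eps delta : R) (q : {poly int}).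
Hypotheses (A_gt0 : (0 < A)%N) (w_ge0 : forall i j t, 0 <= w i j t).
Hypothesis indep : mutually_independent w.
Hypothesis A_eps : A%:R^-1 `^ (1 + eps) <= (4 * A)%:R^-1 :> R.
Hypothesis delta01 : 0 < delta <= 1.
Hypothesis qP : forall u : R, 0 < u <= 1 ->
    let qu := (map_poly intr q).[u] in
    [/\ 0 <= qu <= 1, A%:R^-1 <= u -> 1 - delta <= qu
      & u <= (4 * A)%:R^-1 -> qu <= delta].

Definition laplace (A : nat) (w : 'I_n -> 'I_d -> {RV P >-> R}) (k : 'I_d -> nat) i t : R :=
  A%:R^-1 `^ (\sum_(j < d) (k j)%:R * w i j t).

Let Ainv_gt0 : 0 < A%:R^-1 :> R. Proof. by rewrite invr_gt0 ltr0n. Qed.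
Let Ainv_le1 : A%:R^-1 <= 1 :> R. Proof. by rewrite invf_le1 ?ler1n ?ltr0n. Qed.

Lemma powR_AinvE x : A%:R^-1 `^ x = expR (x * ln A%:R^-1) :> R.
Proof. by rewrite /powR gt_eqF. Qed.

Lemma powR_Ainv_bounds x : 0 <= x -> 0 < (A%:R^-1 `^ x : R) <= 1.
Proof.
move=> x0; rewrite powR_gt0 //= powR_AinvE expR_le1.
by rewrite mulr_ge0_le0 // ln_le0.
Qed.

Lemma laplace_ge0_le1 k i t : 0 <= laplace A w k i t <= 1.
Proof.
have : 0 <= \sum_(j < d) (k j)%:R * w i j t by apply: sumr_ge0 => j _; rewrite mulr_ge0.
by move/powR_Ainv_bounds => /andP[/ltW ? ?]; apply/andP.
Qed.

(** Independence concerns the sigma-algebra generated by [w i], not the ambient one; measurability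
    is therefore proved with [T] carrying the generated structure. *)
Lemma laplace_sigma k i (B : set R) : measurable B ->
  g_sigma_preimage (fun j : 'I_d => w i j : T -> R) (laplace A w k i @^-1` B).
Proof.
move=> mB.
pose G := \big[setU/set0]_(j < d)
  preimage_set_system setT (w i j : T -> R) (measurable : set (set R)).
have mw j : measurable_fun setT (w i j : g_sigma_algebraType G -> R).
  move=> _ C mC; apply: sub_sigma_algebra; rewrite /G (bigD1 j) //=.
  by left; exists C.
suff : measurable_fun setT (laplace A w k i : g_sigma_algebraType G -> R).
  by move=> /(_ measurableT _ mB); rewrite setTI.
have -> : laplace A w k i = fun t => expR ((\sum_(j < d) (k j)%:R * w i j t) * ln A%:R^-1).
  by apply/funext => t; rewrite /laplace powR_AinvE.
apply: measurableT_comp => //; apply: measurable_funM; last exact: measurable_cst.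
apply: measurable_sum => j; apply: measurable_funM => //; exact: measurable_cst.
Qed.

Lemma laplace_mbounded k i : mbounded (laplace A w k i).
Proof.
split; last by exists 1 => t; case/andP: (laplace_ge0_le1 k i t) => ? ?; rewrite ger0_norm.
move=> _ B mB; rewrite setTI; apply: (@g_sigma_preimage_measurable _ _ _ _ _ _ w i).
exact: laplace_sigma.
Qed.

Variable S : {set 'I_n}.

Let u j t : R := A%:R^-1 `^ (\sum_(i in S) w i j t).

Let u01 j t : 0 < u j t <= 1.
Proof. by apply: powR_Ainv_bounds; exact: sumr_ge0. Qed.

(** Exchanging the two sums in the exponent passes from factors indexed by items, which are
    independent, to powers of the [u j], in which the size constraints are expressed. *)
Lemma prod_laplace k t : \prod_(i in S) laplace A w k i t = \prod_(j < d) u j t ^+ k j.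
Proof.
rewrite /u; under eq_bigr do rewrite /laplace powR_AinvE.
under [RHS]eq_bigr do rewrite powR_AinvE -expRM_natl.
rewrite -!(big_morph _ (@expRD R) (@expR0 R)); congr expR.
under eq_bigr do rewrite mulr_suml.
rewrite exchange_big; apply: eq_bigr => j _.
by rewrite mulr_suml mulr_sumr; apply: eq_bigr => i _; rewrite mulrA.
Qed.

Let Q t : R := \prod_(j < d) (map_poly intr q).[u j t].

(** One monomial per choice of an exponent for each coordinate. Exponents range over
    ['I_(size q).+1] instead of ['I_(size q)] so that the index type is inhabited even when [q] is
    zero. *)
Lemma Q_expand t : Q t = \sum_(k : {ffun 'I_d -> 'I_(size q).+1})
  (\prod_(j < d) q`_(k j))%:~R * \prod_(i in S) laplace A w (fun j => k j : nat) i t.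
Proof.
rewrite /Q.
under eq_bigr => j _ do rewrite (@horner_coef_wide _ (size q).+1) ?(leq_trans (size_poly _ _)) //.
rewrite bigA_distr_bigA /=; apply: eq_bigr => k _.
rewrite big_split /= prod_laplace; congr (_ * _).
rewrite rmorph_prod; apply: eq_bigr => j _.
by rewrite coef_map.
Qed.

Lemma Q_mbounded : mbounded Q.
Proof.
rewrite (funext Q_expand); apply: mbounded_sum => k _.
by apply: mboundedM; [exact: mbounded_cst|apply: mbounded_prod => i _; exact: laplace_mbounded].
Qed.

Lemma mean_Q : mean P Q = \sum_(k : {ffun 'I_d -> 'I_(size q).+1})
  (\prod_(j < d) q`_(k j))%:~R *
  \prod_(i in S) mean P (laplace A w (fun j => k j : nat) i).
Proof.
have b k : mbounded (fun t => \prod_(i in S) laplace A w k i t).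
  by apply: mbounded_prod => i _; exact: laplace_mbounded.
rewrite (funext Q_expand) mean_sum; last first.
  by move=> k; apply: mboundedM => //; exact: mbounded_cst.
apply: eq_bigr => k _; rewrite meanZ //; congr (_ * _).
apply: (mean_prod_indep indep) => [i t|i B]; [exact: laplace_ge0_le1|exact: laplace_sigma].
Qed.

Lemma fits_measurable c : measurable (fits w S c).
Proof.
have -> : fits w S c = \bigcap_(j : 'I_d) [set t | \sum_(i in S) w i j t <= c].
  by apply/seteqP; split => t h j; [move=> _; exact: h|exact: h].
apply: fin_bigcap_measurable => // j _.
have : measurable_fun setT (fun t => \sum_(i in S) w i j t).
  rewrite (_ : (fun _ => _) = fun t => \sum_(i <- enum S) w i j t); last first.
    by apply/funext => t; rewrite big_enum.
  by apply: measurable_sum => i.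
move=> /(_ measurableT _ (measurable_itv `]-oo, c])); rewrite setTI.
by congr measurable; apply/funext => t /=; rewrite in_itv.
Qed.

(** On the event that [S] fits, each of the [d] factors is at least [1 - delta], and Bernoulli
    bounds their product from below. *)
Lemma mean_Q_ge : fine (P (fits w S 1)) - d%:R * delta <= mean P Q.
Proof.
have mF := fits_measurable 1.
have /andP[d0 d1] := delta01.
rewrite -mean_indic // -[- _](mean_cst P) -meanD; last 2 first.
  exact: mbounded_indic.
  exact: mbounded_cst.
apply: le_mean; [|exact: Q_mbounded|move=> t].
  by apply: mboundedD; [exact: mbounded_indic|exact: mbounded_cst].
have Q01 : 0 <= Q t by apply: prodr_ge0 => j _; case: (qP (u01 j t)) => /andP[].
rewrite indicE; have [tF|tF] := pselect (fits w S 1 t); last first.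
  by rewrite memNset // add0r (le_trans _ Q01) // oppr_le0 mulr_ge0 // ltW.
rewrite mem_set //=; apply: (@le_trans _ _ ((1 - delta) ^+ d)).
  by rewrite -mulrN; apply: bernoulli_ge; rewrite lerN2.
rewrite -[d in X in X <= _]card_ord -prodr_const; apply: ler_prod => j _.
rewrite subr_ge0 d1 /=; case: (qP (u01 j t)) => _ + _; apply.
rewrite /u -[X in X <= _]powRr1 ?(ltW Ainv_gt0) //; apply: ger_powR; last exact: tF.
by rewrite Ainv_gt0.
Qed.

(** Outside the event, some coordinate exceeds [1 + eps]; its factor is at most [delta] and the
    others are at most 1. *)
Lemma mean_Q_le : mean P Q <= fine (P (fits w S (1 + eps))) + delta.
Proof.
have mF := fits_measurable (1 + eps).
have /andP[d0 d1] := delta01.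
rewrite -mean_indic // -[delta in X in _ <= X](mean_cst P) -meanD; last 2 first.
  exact: mbounded_indic.
  exact: mbounded_cst.
apply: le_mean; [exact: Q_mbounded| |move=> t].
  by apply: mboundedD; [exact: mbounded_indic|exact: mbounded_cst].
have q01 j : 0 <= (map_poly intr q).[u j t] <= 1 by case: (qP (u01 j t)).
rewrite indicE; have [tF|tF] := pselect (fits w S (1 + eps) t).
  rewrite mem_set //= (@le_trans _ _ 1) ?lerDl ?(ltW d0) //.
  by rewrite /Q; apply: prodr_ile1 => j _.
rewrite memNset // add0r; move/existsNP: tF => [j /negP]; rewrite -ltNge => /ltW tj.
rewrite /Q (bigD1 j) //= (@le_trans _ _ (map_poly intr q).[u j t]) //.
  rewrite ler_piMr //; first by case/andP: (q01 j).
  by apply: prodr_ile1 => j' _.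
case: (qP (u01 j t)) => _ _; apply; apply: le_trans A_eps.
by rewrite /u; apply: ger_powR; rewrite ?Ainv_gt0.
Qed.

End Sandwich.

Lemma fits_estimate (R : realType) (d : nat) (eps delta : R) :
  0 < eps -> 0 < delta <= 1 ->
  exists (A K : nat) (f : nat -> 'I_d -> nat) (c : nat -> int), (0 < A)%N /\
  forall (disp : measure_display) (T : measurableType disp) (P : probability T R)
    (n : nat) (w : 'I_n -> 'I_d -> {RV P >-> R}) (S : {set 'I_n}),
  (forall i j t, 0 <= w i j t) -> mutually_independent w ->
  fine (P (fits w S 1)) - delta <=
    \sum_(k < K) (c k)%:~R * \prod_(i in S) mean P (laplace A w (f k) i)
    <= fine (P (fits w S (1 + eps))) + delta.
Proof.
move=> e0 /andP[d0 d1].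
have [A A0 Ae] := base_exists e0.
(* The lower estimate loses [d] times the error of the step polynomial; dividing by [d.+1] absorbs
   this and remains meaningful for [d = 0]. *)
have e'01 : 0 < delta / d.+1%:R <= 1.
  rewrite divr_gt0 ?ltr0n //= ler_pdivrMr ?ltr0n // mul1r (le_trans d1) //.
  by rewrite ler1n.
have e'd : delta / d.+1%:R <= delta by rewrite ler_pdivrMr ?ltr0n // ler_peMr ?ler1n // ltW.
have [q qP] := @step_polynomial R A _ A0 (proj1 (andP e'01)).
pose x0 : {ffun 'I_d -> 'I_(size q).+1} := [ffun=> ord0].
pose ff k := nth x0 (enum {ffun 'I_d -> 'I_(size q).+1}) k.
exists A, #|{ffun 'I_d -> 'I_(size q).+1}|, (fun k j => ff k j : nat),
  (fun k => \prod_(j < d) q`_(ff k j)); split => // disp T P n w S w0 indep.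
have -> : \sum_(k < #|{ffun 'I_d -> 'I_(size q).+1}|)
    (\prod_(j < d) q`_(ff k j))%:~R *
    \prod_(i in S) mean P (laplace A w (fun j => ff k j : nat) i)
  = mean P (fun t => \prod_(j < d) (map_poly intr q).[A%:R^-1 `^ (\sum_(i in S) w i j t)]).
  rewrite (mean_Q q A0 w0 indep).
  by rewrite -[RHS]big_enum (big_nth x0) big_mkord -cardE.
apply/andP; split.
  apply: le_trans _ (mean_Q_ge A0 w0 e'01 qP S).
  rewrite lerD2l lerN2 mulrCA ler_piMr ?(ltW d0) // ler_pdivrMr ?ltr0n //.
  by rewrite mul1r ler_nat.
apply: (le_trans (mean_Q_le A0 w0 Ae e'01 qP S)).
by rewrite lerD2l.
Qed.

(** The test must pass every set with probability at least [gamma], whose score may be too low by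
    [2 * delta], and anything passing it must be acceptable although its score may be too high by
    [2 * delta]. One [delta] is for the proxy, the other for the rounding. *)
Lemma threshold_exists (R : realType) (eps gamma : R) :
  0 < eps -> 0 <= gamma <= 1 ->
  exists (delta : R) (thr : int) (D : nat), [/\ 0 < delta <= 1, (0 < D)%N,
    thr%:~R <= D%:R * (gamma - 2 * delta) &
    forall x : R, 0 <= x -> thr%:~R <= D%:R * (x + 2 * delta) -> (1 - eps) * gamma <= x].
Proof.
move=> e0 /andP[g0 g1]; have [h|h] := leP ((1 - eps) * gamma) 0.
  (* Nothing has to be guaranteed here; the threshold -2 is low enough for every [gamma >= 0]. *)
  exists 1, (-2), 1%N; split => //; first by rewrite ltr01 lexx.
    by rewrite mul1r mulr1 mulrNz; lra.
  move=> x x0 _; exact: le_trans h x0.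
have g0' : 0 < gamma by rewrite lt_neqAle g0 andbT; apply: contraTneq h => <-; rewrite mulr0 ltxx.
have e1 : eps < 1 by rewrite -subr_gt0 -(pmulr_lgt0 _ g0').
pose eta := eps * gamma.
have eta0 : 0 < eta by rewrite mulr_gt0.
have eta1 : eta <= 1 by rewrite mulr_ile1 // ltW.
(* With [delta = eta / 8] the errors add up to [eta / 2]; the other half pays for rounding the
   threshold down, which costs at most 1/D <= [eta / 2]. *)
pose D := (Num.truncn (2 / eta)).+1.
have D0 : 0 < D%:R :> R by rewrite ltr0n.
have De : 2 <= D%:R * eta.
  by rewrite -ler_pdivrMr //; exact/ltW/truncnS_gt.
have [fl fg] : (Num.floor (D%:R * (gamma - 2 * (eta / 8))))%:~R <= D%:R * (gamma - 2 * (eta / 8)) /\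
   D%:R * (gamma - 2 * (eta / 8)) < (Num.floor (D%:R * (gamma - 2 * (eta / 8))))%:~R + 1.
  by split; [apply: real_floor_le|rewrite -[1]/(1%:~R) -intrD; apply: real_floorD1_gt];
    exact: num_real.
exists (eta / 8), (Num.floor (D%:R * (gamma - 2 * (eta / 8)))), D; split => //.
  by apply/andP; split; lra.
move=> x x0 hx; have := lt_le_trans fg (lerD hx (lexx 1)).
rewrite -/D; rewrite (_ : (1 - eps) * gamma = gamma - eta); last by rewrite /eta; ring.
have -> : D%:R * (gamma - 2 * (eta / 8)) = D%:R * gamma - (D%:R * eta) / 4 by field.
have -> : D%:R * (x + 2 * (eta / 8)) + 1 = D%:R * x + (D%:R * eta) / 4 + 1 by field.
move=> H; rewrite -(ler_pM2l D0) mulrBr; lra.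
Qed.

(** * Rounded products as nodes of the graph *)

Definition digit (B k s : nat) : nat := (s %/ B ^ k %% B)%N.

Definition shrink (B K p : nat) (b : nat -> nat -> nat) (i s : nat) : nat :=
  (\sum_(k < K) (digit B k s * b i k %/ 2 ^ p) * B ^ k)%N.

Section Rounding.
Variables (M K p : nat) (b : nat -> nat -> nat).
Let B := M.+1.
Hypotheses (M_p : (2 * M < 2 ^ p)%N) (b_le : forall i k, (b i k <= 2 ^ p + 2)%N).

Lemma digit_le k s : (digit B k s <= M)%N.
Proof. by rewrite -ltnS ltn_mod. Qed.

(** A multiplier may exceed [2 ^ p] by 2, but 2m < 2^p makes this excess vanish in the integer
    division. Digits thus never exceed [M], and packing produces no carry. *)
Lemma shrunk_le i k m : (m <= M)%N -> (m * b i k %/ 2 ^ p <= m)%N.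
Proof.
move=> mM; rewrite -ltnS ltn_divLR ?expn_gt0 // mulSn.
by have := leq_mul2l m (b i k) (2 ^ p + 2); rewrite b_le orbT => ?; lia.
Qed.

Lemma shrink_lt i s : (shrink B K p b i s < B ^ K)%N.
Proof.
apply: (@digits_lt B (fun k => digit B k s * b i k %/ 2 ^ p)%N) => k _.
by rewrite ltnS (leq_trans (shrunk_le _ _ _)) //; exact: digit_le.
Qed.

Lemma digit_shrink i s k : (k < K)%N ->
  digit B k (shrink B K p b i s) = (digit B k s * b i k %/ 2 ^ p)%N.
Proof.
move=> kK; have := @digits_nth B isT (fun k => digit B k s * b i k %/ 2 ^ p)%N K 0 k kK.
rewrite mul0n add0n; apply => j _.
by rewrite ltnS (leq_trans (shrunk_le _ _ _)) //; exact: digit_le.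
Qed.

Lemma digit_start k : (k < K)%N -> digit B k (B ^ K).-1 = M.
Proof.
move=> kK; have := @digits_nth B isT (fun=> M) K 0 k kK (fun _ _ => ltnSn M).
by rewrite mul0n add0n -big_distrr /= -[M in (M * _)%N]/(B.-1) -predn_exp.
Qed.

Lemma digit_mod s k : (k < K)%N -> digit B k (s %% B ^ K) = digit B k s.
Proof.
move=> kK.
have sE : s = ((s %/ B ^ K * B ^ (K - k.+1) * B) * B ^ k + s %% B ^ K)%N.
  rewrite {1}(divn_eq s (B ^ K)); congr addn.
  by rewrite -!mulnA -expnS -expnD subnK.
by rewrite /digit [in RHS]sE divnMDl ?expn_gt0 // modnMDl.
Qed.

Variables (R : realType) (a : nat -> nat -> R) (X : pred nat).
Hypotheses (a01 : forall i k, 0 <= a i k <= 1)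
  (b_a : forall i k, `|2 ^+ p * a i k - ((b i k)%:R - 1)| <= 1).

(** The earlier error is multiplied by a factor at most 1, so it does not grow, and each selected
    item adds at most 1. *)
Lemma rounding_error i k : (k < K)%N ->
  `|(digit B k (node (B ^ K).-1 (shrink B K p b) X i))%:R
    - M%:R * \prod_(l < i | X l) a l k| <= i%:R.
Proof.
move=> kK; elim: i => [|i IH] /=.
  by rewrite digit_start // big_ord0 mulr1 subrr normr0.
rewrite big_mkcond big_ord_recr -big_mkcond /=; case: (X i); last first.
  by rewrite mulr1 (le_trans IH) // ler_nat.
rewrite digit_shrink //; move: IH (digit_le k (node (B ^ K).-1 (shrink B K p b) X i)).
set m := digit _ _ _; set y := M%:R * _ => IH mM.
have := leq_divM (m * b i k) (2 ^ p).
have := ltn_ceil (m * b i k) (expn_gt0 2 p).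
set m' := (_ %/ _)%N.
rewrite -(ltr_nat R) -(ler_nat R) !natrM !natrX -natr1 => H1 H2.
have p0 : 0 < 2 ^+ p :> R by rewrite exprn_gt0.
have mp : 2 * m%:R <= 2 ^+ p :> R.
  by rewrite -natrX -natrM ler_nat (leq_trans _ (ltnW M_p)) // leq_mul2l mM.
have m0 : 0 <= m%:R :> R by [].
have /andP[a0 a1] := a01 i k.
(* [b i k] lies between 2^p a and 2^p a + 2, so m b / 2^p exceeds m a by at most 2m / 2^p <= 1;
   rounding down then loses less than 1. *)
have step : `|m'%:R - m%:R * a i k| <= 1.
  have := b_a i k; rewrite ler_norml ler_norml => /andP[b1 b2].
  have := ler_wpM2l m0 b1; have := ler_wpM2l m0 b2.
  move=> {}b2 {}b1; apply/andP; split; rewrite -(ler_pM2r p0); nra.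
rewrite mulrA -/y.
have -> : m'%:R - y * a i k = (m'%:R - m%:R * a i k) + (m%:R - y) * a i k by ring.
rewrite (le_trans (ler_normD _ _)) // -natr1 [i%:R + 1]addrC lerD // normrM.
by rewrite (le_trans _ IH) // ler_piMr // ger0_norm.
Qed.

End Rounding.

(** * The algorithm *)

Definition put_max x a e : cmd := If (Defs.Sub e (Get x a)) (Put x a e) Skip.

Section Program.
Variables (d K A C c0 D0 : nat) (thr : int) (f : nat -> nat -> nat) (c : nat -> int).

(* Array 3 holds the loop counter, 4 the powers of two, 5 the table, 6 and 7
   the frequencies and the answer of a query, 8 the node under construction
   and 9 the best accepted entry. *)
Definition eN := Get 0 (Cst 0).
Definition eM := Mul (Cst C%:Z) (Add eN (Cst 1)).
Definition eB := Add eM (Cst 1).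
Definition ePow e k := iter k (Mul e) (Cst 1).
Definition eL := ePow eB K.
Definition eIdx := Get 3 (Cst 0).
Definition eItem := Div eIdx eL.
Definition ePrec := Add eN (Cst c0%:Z).
Definition eScale := Mul (Get 4 eN) (Cst (2 ^ c0)%N%:Z).
Definition eMod a b := Defs.Sub a (Mul (Div a b) b).
Definition eDigit k := eMod (Div eIdx (ePow eB k)) eB.
(* The profit is stored above an n-bit mask of the selected items: comparing
   entries compares profits, and the low bits of an entry give the set. *)
Definition eW := Add (Mul (Get 1 eItem) (Get 4 eN)) (Get 4 eItem).
Fixpoint eScore k :=
  if k is k'.+1 then Add (eScore k') (Mul (Cst (c k')) (eDigit k')) else Cst 0.
(** Adding 1 turns the weak inequality between integers into the strict positivity tested by
    [If]. *)
Definition eAccept :=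
  Add (Defs.Sub (Mul (Cst D0%:Z) (eScore K)) (Mul (Cst thr) eM)) (Cst 1).

Definition next := Put 3 (Cst 0) (Add eIdx (Cst 1)).
Definition loop bound body := While (Defs.Sub bound eIdx) (Seq body next).

Definition digit_step k :=
  Seq (unroll (fun j => Put 6 (Cst j%:Z) (Cst (f k j)%:Z)) 0 d)
  (Seq (Ask eItem (Cst 1) (Cst 0) (Cst A%:Z) 6 ePrec 7)
       (Put 8 (Cst 0)
          (Add (Get 8 (Cst 0))
               (Mul (Div (Mul (eDigit k) (Add (Get 7 (Cst 0)) (Cst 1))) eScale)
                    (ePow eB k))))).

Definition relax_step :=
  Seq (Put 8 (Cst 0) (Cst 0))
  (Seq (unroll digit_step 0 K)
       (If (Get 5 eIdx)
           (Seq (put_max 5 (Add eIdx eL) (Get 5 eIdx))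
                (put_max 5 (Add (Mul (Add eItem (Cst 1)) eL) (Get 8 (Cst 0)))
                           (Add (Get 5 eIdx) eW)))
           Skip)).

Definition scan_step := If eAccept (put_max 9 (Cst 0) (Get 5 eIdx)) Skip.

Definition power_step := Put 4 (Add eIdx (Cst 1)) (Mul (Get 4 eIdx) (Cst 2)).

Definition decode_step :=
  Put 2 eIdx (eMod (Div (Defs.Sub (Get 9 (Cst 0)) (Cst 1)) (Get 4 eIdx)) (Cst 2)).

(** The counter is not reset before the scan: the relaxation loop leaves it at [n * L], the first
    node of the last layer. The first table entry set, at [eL - 1], is the node all of whose digits
    are [M], that is, the empty product. *)
Definition knapsack_cmd :=
  Seq (Put 4 (Cst 0) (Cst 1))
  (Seq (loop eN power_step)
  (Seq (Put 3 (Cst 0) (Cst 0))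
  (Seq (Put 5 (Defs.Sub eL (Cst 1)) (Cst 1))
  (Seq (loop (Mul eN eL) relax_step)
  (Seq (loop (Mul (Add eN (Cst 1)) eL) scan_step)
  (Seq (Put 3 (Cst 0) (Cst 0))
       (loop eN decode_step))))))).

(** * Verification of the program *)

Variables (O : oracle d) (n : nat) (v : nat -> nat) (h : nat).
Let M := (C * n.+1)%N.
Let B := M.+1.
Let L := (B ^ K)%N.
Let p := (n + c0)%N.
Let r := (n.+1 * L)%N.

Definition item_query i k : query d :=
  Query i%:Z 1 0 A%:Z [ffun j : 'I_d => (f k j)%:Z] p.

Variable b : nat -> nat -> nat.
Hypotheses (b_ans : forall i k, (i < n)%N -> (k < K)%N ->
    (O (item_query i k)).1 + 1 = (b i k)%:Z)
  (ans_lt : forall i k, (i < n)%N -> (k < K)%N ->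
    (`|(O (item_query i k)).1| < 2 ^ h)%N /\ (`|(O (item_query i k)).2| < 2 ^ h)%N)
  (M_p : (2 * M < 2 ^ p)%N) (b_le : forall i k, (b i k <= 2 ^ p + 2)%N).

Let W i := (v i * 2 ^ n + 2 ^ i)%N.
Let tr := shrink B K p b.
Let start := L.-1.
Let tab := table L start tr W.

Hypotheses (h_gt0 : (0 < h)%N) (p_h : (p < h)%N)
  (f_h : forall k j, (k < K)%N -> (j < d)%N -> (f k j < 2 ^ h)%N)
  (r_h : (r < 2 ^ h)%N) (W_h : (weight W xpredT n < 2 ^ h)%N).

Let L_gt0 : (0 < L)%N. Proof. by rewrite expn_gt0. Qed.
Let start_lt : (start < L)%N. Proof. by rewrite ltn_predL. Qed.
Let tr_lt i s : (s < L)%N -> (tr i s < L)%N.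
Proof. by move=> _; exact: shrink_lt. Qed.

Local Notation wp := (wp O h r).
Local Notation bounded := (bounded h).

(** Both branches are described as one update, because writing back the old value of a cell leaves
    the store unchanged. *)
Lemma wp_put_max x a e (Q : store -> Prop) s :
  bounded s -> (`|Defs.eval s e| < 2 ^ h)%N ->
  Q (upd s x (Defs.eval s a)
       (if s x (Defs.eval s a) < Defs.eval s e then Defs.eval s e else s x (Defs.eval s a))) ->
  wp (put_max x a e) Q s.
Proof.
move=> bs eh q; apply: wp_if => //= [he|he].
  by apply: wp_put => //; move: q; rewrite -subr_gt0 he.
apply: wp_skip => //; move: q; rewrite -subr_gt0 ltNge he /=; congr Q.
apply/funext => y; apply/funext => z; rewrite /upd.
by case: ifP => // /andP[/eqP -> /eqP ->].
Qed.

Definition at_index (j : nat) (s : store) : Prop :=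
  [/\ s 0%N 0 = n%:Z, forall i, (i < n)%N -> s 1%N i%:Z = (v i)%:Z & s 3%N 0 = j%:Z].

Definition powers (m : nat) (s : store) : Prop :=
  forall i, (i <= m)%N -> s 4%N i%:Z = (2 ^ i)%N%:Z.

Section Evaluation.
Variables (s : store).
Hypothesis s_n : s 0%N 0 = n%:Z.

Lemma eval_eM : Defs.eval s eM = M%:Z.
Proof. by rewrite /eM /= s_n /M -addn1 !PoszM PoszD. Qed.

Lemma eval_eB : Defs.eval s eB = B%:Z.
Proof. by rewrite -[LHS]/(Defs.eval s eM + 1) eval_eM /B -addn1 PoszD. Qed.

Lemma eval_ePow k : Defs.eval s (ePow eB k) = (B ^ k)%N%:Z.
Proof.
elim: k => // k IH.
by rewrite -[LHS]/(Defs.eval s eB * Defs.eval s (ePow eB k)) IH eval_eB expnS PoszM.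
Qed.

Lemma eval_eL : Defs.eval s eL = L%:Z. Proof. exact: eval_ePow. Qed.

Variable j : nat.
Hypothesis s_j : s 3%N 0 = j%:Z.

Lemma eval_eItem : Defs.eval s eItem = (j %/ L)%N%:Z.
Proof. by rewrite -[LHS]/(s 3%N 0 %/ Defs.eval s eL)%Z eval_eL s_j divz_nat. Qed.

Lemma eval_eMod a e : Defs.eval s (eMod a e) =
  Defs.eval s a - (Defs.eval s a %/ Defs.eval s e)%Z * Defs.eval s e.
Proof. by []. Qed.

Lemma eval_eDigit k : Defs.eval s (eDigit k) = (digit B k j)%:Z.
Proof.
rewrite /eDigit eval_eMod -[Defs.eval s (Div _ _)]/(s 3%N 0 %/ Defs.eval s (ePow eB k))%Z.
rewrite eval_ePow eval_eB s_j !divz_nat /digit.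
by rewrite {1}(divn_eq (j %/ B ^ k) B) PoszD PoszM addrAC subrr add0r.
Qed.

Lemma eval_eScore k : Defs.eval s (eScore k) = \sum_(i < k) c i * (digit B i j)%:Z.
Proof.
elim: k => [|k IH]; first by rewrite big_ord0.
by rewrite big_ord_recr -IH -eval_eDigit.
Qed.

Lemma eval_eAccept : (0 < Defs.eval s eAccept) =
  (thr * M%:Z <= D0%:Z * \sum_(k < K) c k * (digit B k j)%:Z).
Proof.
rewrite -[Defs.eval s _]/(D0%:Z * Defs.eval s (eScore K) - thr * Defs.eval s eM + 1).
rewrite eval_eScore eval_eM.
by move: (D0%:Z * _) (thr * _) => x y; lia.
Qed.

End Evaluation.

(** The body may not touch the input or the counter, and [J] may not depend on array 3, so the
    increment of the counter preserves it. The start [m] is arbitrary for the sake of the scan. *)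
Lemma wp_loop (J : nat -> store -> Prop) m N bound body (Q : store -> Prop) s :
  (m <= N <= r)%N -> {in [:: 0; 1; 3]%N, forall x, x \notin writes body} ->
  bounded s -> at_index m s -> J m s ->
  (forall s', s' 0%N 0 = n%:Z -> Defs.eval s' bound = N%:Z) ->
  (forall j s1 s2, (forall x, x != 3%N -> s2 x = s1 x) -> J j s1 -> J j s2) ->
  (forall j s', (m <= j < N)%N -> bounded s' -> at_index j s' -> J j s' ->
     wp body (J j.+1) s') ->
  (forall s', bounded s' -> at_index N s' -> J N s' -> Q s') ->
  wp (loop bound body) Q s.
Proof.
move=> /andP[mN Nr] wbody bs as_ Js Ebound Jext step post.
pose I j s' := at_index (m + j) s' /\ J (m + j)%N s'.
apply: (@wp_while _ _ _ _ h_gt0 I (N - m)%N) => //.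
- by rewrite (leq_trans _ Nr) // leq_subr.
- by rewrite /I addn0.
- move=> j s' jN bs' [[s0 s1 s3] Js']; split.
    by rewrite /= Ebound // s3 subr_gt0 ltz_nat; lia.
  apply: wp_seq; apply: wp_mono (step (m + j)%N s' _ bs' (And3 s0 s1 s3) Js'); last by lia.
  move=> s2 bs2 frame J2.
  have E : Defs.eval s2 (Add eIdx (Cst 1)) = (m + j).+1%:Z.
    by rewrite /= frame ?s3 ?(wbody 3%N) // -addn1 PoszD.
  apply: wp_put => //; rewrite E /=.
    by apply: leq_ltn_trans r_h; lia.
  rewrite /I addnS; split.
    by split => // [|i iN]; rewrite /upd /= frame ?s0 ?s1 ?wbody.
  by apply: Jext J2 => x x3; apply/funext => y; rewrite /upd (negbTE x3).
- move=> s' bs' [[s0 s1 s3] Js'].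
  have mNN : (m + (N - m) = N)%N by lia.
  rewrite mNN in s3 Js'; split; last by apply: post.
  by rewrite /= Ebound // s3 subrr.
Qed.

Lemma writes_unroll x F m k :
  (forall j, x \notin writes (F j)) -> x \notin writes (unroll F m k).
Proof. by move=> xF; elim: k m => //= k IH m; rewrite mem_cat negb_or xF IH. Qed.

Let partial_node j k :=
  (\sum_(l < k) (digit B l j * b (j %/ L) l %/ 2 ^ p) * B ^ l)%N.

Lemma partial_node_lt j k : (k <= K)%N -> (partial_node j k < 2 ^ h)%N.
Proof.
move=> kK; apply: leq_trans (ltnW r_h).
have := @digits_lt B (fun l => digit B l j * b (j %/ L) l %/ 2 ^ p)%N k _.
move=> /(_ _)/leq_trans; apply.
  by move=> l _; rewrite ltnS (leq_trans (shrunk_le M_p b_le _ _ _)) //; exact: digit_le.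
by rewrite /r mulSn (leq_trans _ (leq_addr _ _)) // leq_pexp2l.
Qed.

(** The program takes digits of the full index [j]; since [L] is a power of [B], the layer number
    above them does not interfere. *)
Lemma partial_nodeE j : partial_node j K = tr (j %/ L) (j %% L).
Proof. by apply: eq_bigr => k _; rewrite digit_mod. Qed.

Lemma item_lt j : (j < n * L)%N -> (j %/ L < n)%N.
Proof. by move=> jn; rewrite ltn_divLR. Qed.

Lemma wp_digit_step j k s : bounded s -> at_index j s -> powers n s ->
  (j < n * L)%N -> (k < K)%N -> s 8%N 0 = (partial_node j k)%:Z ->
  wp (digit_step k) (fun s' => s' 8%N 0 = (partial_node j k.+1)%:Z) s.
Proof.
move=> bs [s0 s1 s3] s4 jn kK s8; have i_n := item_lt jn.
apply: wp_seq.
pose I m s' := (forall x, x != 6%N -> s' x = s x) /\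
  forall l, (l < m)%N -> s' 6%N l%:Z = (f k l)%:Z.
have : wp (unroll (fun j => Put 6 (Cst j%:Z) (Cst (f k j)%:Z)) 0 d) (I (0 + d)%N) s.
  apply: wp_unroll => // l s' /andP[_ ld] bs' [E F]; apply: wp_put => //=.
    exact: f_h.
  split=> [x x6|l']; first by apply/funext => y; rewrite /upd (negbTE x6) E.
  rewrite ltnS leq_eqVlt /upd /= eqz_nat => /orP[/eqP->|l'l]; first by rewrite eqxx.
  by rewrite (ltn_eqF l'l) F.
apply: wp_mono => s' bs' _ [E F].
have E0 : s' 0%N 0 = n%:Z by rewrite E.
have E3 : s' 3%N 0 = j%:Z by rewrite E.
have Eq : mkquery s' eItem (Cst 1) (Cst 0) (Cst A%:Z) 6 ePrec = item_query (j %/ L) k.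
  rewrite /mkquery /item_query (eval_eItem E0 E3) /= E0 -PoszD absz_nat; congr Query.
  by apply/ffunP => l; rewrite !ffunE F.
have [A1 A2] := ans_lt i_n kK.
apply/wp_seq/wp_ask; rewrite ?Eq //.
  by rewrite /= E0 -PoszD absz_nat ltnW.
set s2 := upd _ _ _ _.
have V : Defs.eval s2 (Add (Get 8 (Cst 0))
      (Mul (Div (Mul (eDigit k) (Add (Get 7 (Cst 0)) (Cst 1))) eScale) (ePow eB k)))
    = (partial_node j k.+1)%:Z.
  rewrite -[LHS]/(s2 8%N 0 + ((Defs.eval s2 (eDigit k) * (s2 7%N 0 + 1)) %/
     (s2 4%N (s2 0%N 0) * (2 ^ c0)%N%:Z))%Z * Defs.eval s2 (ePow eB k)).
  rewrite (eval_eDigit (s := s2) E0 E3) (eval_ePow (s := s2) E0).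
  rewrite -[s2 8%N 0]/(s' 8%N 0) -[s2 0%N 0]/(s' 0%N 0) -[s2 4%N _]/(s' 4%N _).
  rewrite -[s2 7%N 0]/(O (item_query (j %/ L) k)).1 b_ans // E // s8 E0 E // s4 //.
  by rewrite -!PoszM divz_nat -PoszM -PoszD -expnD /partial_node big_ord_recr.
apply: wp_put; rewrite ?V //.
- by do 2 apply: bounded_upd => //.
- exact: partial_node_lt.
Qed.

Lemma upd_set_max (s : store) (T : nat -> nat) (a e : nat) :
  (forall a', s 5%N a'%:Z = (T a')%:Z) -> forall a',
  upd s 5 a%:Z (if s 5%N a%:Z < e%:Z then e%:Z else s 5%N a%:Z) 5%N a'%:Z =
  (set_max T a e a')%:Z.
Proof.
move=> sT a'; rewrite /upd /= eqz_nat set_maxE !sT ltz_nat /maxn.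
by case: eqP => // _; case: ifP.
Qed.

Lemma leq_weight X i k : (i <= k)%N -> (weight W X i <= weight W X k)%N.
Proof.
move=> ik; rewrite -(subnKC ik); elim: (k - i)%N => [|m IH]; first by rewrite addn0.
by rewrite addnS weightS (leq_trans IH) // leq_addr.
Qed.

Lemma tab_lt j a : (a < n.+1 * L)%N -> (tab j a < 2 ^ h)%N.
Proof.
move=> an; apply: leq_ltn_trans W_h; apply: (leq_trans (table_le W start_lt tr_lt _ _)).
by apply: leq_weight; rewrite -ltnS ltn_divLR.
Qed.

Lemma digit_step_writes x k : x \notin [:: 6; 7; 8]%N -> x \notin writes (digit_step k).
Proof.
rewrite !inE !negb_or => /and3P[x6 x7 x8].
by rewrite /= mem_cat negb_or writes_unroll //= !inE ?negb_or ?x6 ?x7 ?x8.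
Qed.

Lemma relax_step_writes x :
  x \notin [:: 5; 6; 7; 8]%N -> x \notin writes relax_step.
Proof.
rewrite in_cons negb_or => /andP[x5 x678].
have x8 : x != 8%N by apply: contraNneq x678 => ->.
rewrite -[writes _]/(8%N :: (writes (unroll digit_step 0 K) ++ [:: 5; 5]%N)).
rewrite in_cons mem_cat !negb_or x8 writes_unroll => [|k]; last exact: digit_step_writes.
by rewrite x5.
Qed.

Lemma wp_relax_step j s : bounded s -> at_index j s -> powers n s ->
  (j < n * L)%N -> (forall a : nat, s 5%N a%:Z = (tab j a)%:Z) ->
  wp relax_step (fun s' => powers n s' /\ forall a : nat, s' 5%N a%:Z = (tab j.+1 a)%:Z) s.
Proof.
move=> bs [s0 s1 s3] s4 jn s5; have i_n := item_lt jn.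
apply: wp_mono (_ : wp relax_step (fun s' => forall a : nat, s' 5%N a%:Z = (tab j.+1 a)%:Z) s).
  by move=> s' _ frame s5'; split => // i iN; rewrite frame ?s4 // relax_step_writes.
apply/wp_seq/wp_put => //=; first by rewrite expn_gt0.
pose I k s' := (forall x, x \notin [:: 6; 7; 8]%N -> s' x = s x) /\
  s' 8%N 0 = (partial_node j k)%:Z.
apply: wp_seq; set s' := upd _ _ _ _.
have : wp (unroll digit_step 0 K) (I (0 + K)%N) s'.
  apply: wp_unroll => //.
  - by apply: bounded_upd => //; rewrite expn_gt0.
  - split=> [x|]; last by rewrite /partial_node big_ord0.
    rewrite !inE !negb_or => /and3P[_ _ x8].
    by apply/funext => y; rewrite /s' /upd (negbTE x8).
  move=> k s2 /andP[_ kK] bs2 [E E8].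
  apply: wp_mono (wp_digit_step bs2 _ _ jn kK E8).
  - move=> s3' _ frame s8'; split => // x x678.
    by rewrite frame ?E // digit_step_writes.
  - by split; rewrite ?E // => i iN; rewrite E ?s1.
  - by move=> i iN; rewrite E ?s4.
apply: wp_mono => s2 bs2 _ [E]; rewrite add0n partial_nodeE => E8.
have E0 : s2 0%N 0 = n%:Z by rewrite E.
have E3 : s2 3%N 0 = j%:Z by rewrite E.
have E5 a : s2 5%N a%:Z = (tab j a)%:Z by rewrite E.
have V1 : Defs.eval s2 (Get 5 eIdx) = (tab j j)%:Z by rewrite /= E3 E5.
have jr : (j < n.+1 * L)%N by rewrite mulSn (leq_trans jn) // leq_addl.
have jL : (j == j + L)%N = false by apply/eqP; lia.
apply: wp_if => //; rewrite V1 => Tj; last first.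
  apply: wp_skip => // a; rewrite E5 /tab /= /relax.
  by rewrite leNgt ltz_nat in Tj; rewrite (negbTE Tj).
apply/wp_seq/wp_put_max => //; rewrite V1 ?tab_lt //.
have -> : Defs.eval s2 (Add eIdx eL) = (j + L)%N%:Z.
  by rewrite -[LHS]/(s2 3%N 0 + Defs.eval s2 eL) (eval_eL E0) E3 PoszD.
set s3' := upd _ _ _ _; have T1 := upd_set_max (j + L) (tab j j) E5.
rewrite -/s3' in T1.
have V2 : Defs.eval s3' (Add (Get 5 eIdx) eW) = (tab j j + W (j %/ L))%N%:Z.
  rewrite -[LHS]/(s3' 5%N (s2 3%N 0) + (s2 1%N (Defs.eval s3' eItem) * s2 4%N (s2 0%N 0) +
    s2 4%N (Defs.eval s3' eItem))) (eval_eItem (s := s3') E0 E3) E3 E0 T1 set_maxE jL.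
  by rewrite !E // s1 // !s4 ?(ltnW i_n) // -PoszM -!PoszD.
have V3 : Defs.eval s3' (Add (Mul (Add eItem (Cst 1)) eL) (Get 8 (Cst 0))) =
    ((j %/ L).+1 * L + tr (j %/ L) (j %% L))%N%:Z.
  rewrite -[LHS]/((Defs.eval s3' eItem + 1) * Defs.eval s3' eL + s2 8%N 0).
  by rewrite (eval_eItem (s := s3') E0 E3) (eval_eL (s := s3') E0) E8 -addn1 !PoszD.
apply: wp_put_max.
- by apply: bounded_upd => //; case: ifP => // _; exact: tab_lt.
- rewrite V2 absz_nat; apply: leq_ltn_trans W_h.
  apply: leq_trans (leq_weight _ i_n); rewrite weightS mul1n leq_add2r.
  exact: table_le.
rewrite V2 V3 => a; rewrite (upd_set_max _ _ T1).
rewrite /tab /= /relax -/tab; rewrite ltz_nat in Tj; rewrite Tj.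
by rewrite (_ : set_max _ (j + L) _ j = tab j j) // set_maxE jL.
Qed.

Let accepted : pred nat := fun j =>
  thr * M%:Z <= D0%:Z * \sum_(k < K) c k * (digit B k j)%:Z.

Let entries := tab (n * L).

Lemma wp_scan_step j s : bounded s -> at_index j s -> powers n s ->
  (n * L <= j < r)%N -> (forall a : nat, s 5%N a%:Z = (entries a)%:Z) ->
  s 9%N 0 = (scan accepted entries (n * L) (j - n * L))%:Z ->
  wp scan_step (fun s' => s' 9%N 0 = (scan accepted entries (n * L) (j.+1 - n * L))%:Z) s.
Proof.
move=> bs [s0 s1 s3] s4 /andP[nj jr] s5 s9.
rewrite subSn //= subnKC //.
have V : Defs.eval s (Get 5 eIdx) = (entries j)%:Z by rewrite /= s3 s5.
apply: wp_if => //.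
  rewrite (eval_eAccept s0 s3) -/(accepted j) => aj; rewrite aj.
  apply: wp_put_max; rewrite ?V ?tab_lt // -[Defs.eval s (Cst 0)]/(0 : int) s9.
  by rewrite /upd /= ltz_nat /maxn; case: ifP.
rewrite leNgt (eval_eAccept s0 s3) -/(accepted j) => /negbTE ->.
exact: wp_skip.
Qed.

Let best := scan accepted entries (n * L) L.

Lemma knapsack_cmd_correct s :
  bounded s -> s 0%N 0 = n%:Z -> (forall i, (i < n)%N -> s 1%N i%:Z = (v i)%:Z) ->
  (forall x a, (1 < x)%N -> s x a = 0) -> (0 < best)%N ->
  wp knapsack_cmd (fun s' => forall i, (i < n)%N ->
    s' 2%N i%:Z = (best.-1 %/ 2 ^ i %% 2)%N%:Z) s.
Proof.
move=> bs s0 s1 sz best0.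
have h1 : (1 < 2 ^ h)%N by rewrite -{1}(expn0 2) ltn_exp2l.
have nr : (n <= r)%N by rewrite (leq_trans (leqnSn n)) // leq_pmulr.
have nLr : (n * L <= r)%N by rewrite leq_mul2r leqnSn orbT.
have pow_h i : (i < n)%N -> (2 ^ i.+1 < 2 ^ h)%N.
  by move=> i_n; rewrite ltn_exp2l //; move: p_h; rewrite /p; lia.
apply/wp_seq/wp_put => //; set sa := upd _ _ _ _.
have bsa : bounded sa by exact: bounded_upd.
apply: wp_seq.
apply: (@wp_loop (fun j s' => powers j s' /\
  forall x a, x \in [:: 5; 9]%N -> s' x a = 0) 0 n) => //.
- by move=> x; rewrite !inE => /or3P[] /eqP ->.
- by split=> //; exact: sz.
- split=> [i|x a]; first by rewrite leqn0 => /eqP ->.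
  by rewrite !inE => /orP[] /eqP ->; exact: sz.
- move=> j s2 s3 E [H1 H2]; split=> [i ij|x a x59]; first by rewrite E // H1.
  by rewrite E ?H2 //; move: x59; rewrite !inE => /orP[] /eqP ->.
- move=> j s' /andP[_ jn] bs' [s0' s1' s3'] [H1 H2].
  have V : Defs.eval s' (Mul (Get 4 eIdx) (Cst 2)) = (2 ^ j.+1)%N%:Z.
    by rewrite /= s3' H1 // expnSr PoszM.
  apply: wp_put => //; rewrite V; first exact: pow_h.
  rewrite -[Defs.eval s' _]/(s' 3%N 0 + 1) s3'; split.
    move=> i; rewrite leq_eqVlt /upd /= -PoszD addn1 eqz_nat => /orP[/eqP->|ij].
      by rewrite eqxx.
    by rewrite (ltn_eqF ij) H1.
  by move=> x a; rewrite !inE => /orP[] /eqP ->; apply: H2.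
move=> s2 bs2 [s02 s12 s32] [pw2 z2].
apply/wp_seq/wp_put => //; first by rewrite expn_gt0.
set s3 := upd _ _ _ _.
have bs3 : bounded s3 by apply: bounded_upd => //; rewrite expn_gt0.
apply/wp_seq/wp_put => //.
have -> : Defs.eval s3 (Defs.Sub eL (Cst 1)) = start%:Z.
  by rewrite -[LHS]/(Defs.eval s3 eL - 1) (eval_eL (s := s3) s02) /start (predn_int L_gt0).
set s4 := upd _ _ _ _.
have bs4 : bounded s4 by exact: bounded_upd.
apply: wp_seq.
apply: (@wp_loop (fun j s' => [/\ powers n s', forall a : nat, s' 5%N a%:Z = (tab j a)%:Z
    & s' 9%N 0 = 0]) 0 (n * L)) => //.
- by move=> x x013; apply: relax_step_writes; move: x x013; apply/allP.
- split=> //; last exact: z2.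
  move=> a; rewrite /s4 /upd /= eqz_nat; case: eqP => // _; exact: z2.
- by move=> s' E; rewrite -[LHS]/(s' 0%N 0 * Defs.eval s' eL) eval_eL // E PoszM.
- by move=> j s' s'' E [H1 H2 H3]; split => [i ij|a|]; rewrite E ?H1 ?H2.
- move=> j s' /andP[_ jn] bs' at' [H1 H2 H3].
  apply: wp_mono (wp_relax_step bs' at' H1 jn H2) => s'' _ frame [H1' H2'].
  by split=> //; rewrite frame // relax_step_writes.
move=> s5 bs5 at5 [pw5 tab5 z5].
apply: wp_seq.
apply: (@wp_loop (fun j s' => [/\ powers n s', forall a : nat, s' 5%N a%:Z = (entries a)%:Z
    & s' 9%N 0 = (scan accepted entries (n * L) (j - n * L))%:Z]) (n * L) r) => //.
- by rewrite nLr leqnn.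
- by move=> x; rewrite !inE => /or3P[] /eqP ->.
- by split=> //; rewrite subnn.
- move=> s' E; rewrite -[LHS]/((s' 0%N 0 + 1) * Defs.eval s' eL) eval_eL // E.
  by rewrite /r PoszM -addn1 PoszD.
- by move=> j s' s'' E [H1 H2 H3]; split => [i ij|a|]; rewrite E ?H1 ?H2.
- move=> j s' jn bs' at' [H1 H2 H3].
  apply: wp_mono (wp_scan_step bs' at' H1 jn H2 H3) => s'' _ frame H3'.
  by split=> // [i ij|a]; rewrite frame ?H1 ?H2.
move=> s6 bs6 [s06 s16 s36] [pw6 tab6].
have -> : (r - n * L = L)%N by rewrite /r mulSn addnK.
rewrite -/best => best6.
apply/wp_seq/wp_put => //; first by rewrite expn_gt0.
set s7 := upd _ _ _ _; have bs7 : bounded s7 by apply: bounded_upd => //; rewrite expn_gt0.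
apply: (@wp_loop (fun j s' => [/\ powers n s', s' 9%N 0 = best%:Z
    & forall i, (i < j)%N -> s' 2%N i%:Z = (best.-1 %/ 2 ^ i %% 2)%N%:Z]) 0 n) => //.
- by move=> x; rewrite !inE => /or3P[] /eqP ->.
- by move=> j s' s'' E [H1 H2 H3]; split => [i ij||i ij]; rewrite E ?H1 ?H3.
- move=> j s' /andP[_ jn] bs' [s0' s1' s3'] [H1 H2 H3].
  have V : Defs.eval s' (eMod (Div (Defs.Sub (Get 9 (Cst 0)) (Cst 1)) (Get 4 eIdx)) (Cst 2))
      = (best.-1 %/ 2 ^ j %% 2)%N%:Z.
    rewrite eval_eMod -[Defs.eval s' (Div _ _)]/((s' 9%N 0 - 1) %/ s' 4%N (s' 3%N 0))%Z.
    rewrite H2 s3' H1 1?ltnW //.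
    have -> : best%:Z - 1 = best.-1%:Z by lia.
    rewrite divz_nat -[Defs.eval s' _]/2%:Z divz_nat.
    by rewrite {1}(divn_eq (best.-1 %/ 2 ^ j) 2) PoszD PoszM addrAC subrr add0r.
  apply: wp_put => //; rewrite V.
    by rewrite absz_nat (leq_trans (ltn_pmod _ _)).
  rewrite -[Defs.eval s' eIdx]/(s' 3%N 0) s3'; split => // i.
  rewrite ltnS leq_eqVlt /upd /= eqz_nat => /orP[/eqP->|ij]; first by rewrite eqxx.
  by rewrite (ltn_eqF ij) H3.
by move=> s' _ _ [].
Qed.

End Program.

(** * Correctness *)

Lemma leq_expn2r m n e : (m <= n)%N -> (m ^ e <= n ^ e)%N.
Proof. by case: e => // e mn; rewrite leq_exp2r. Qed.

Lemma cmd_bound_mono d h r r' c : (r <= r')%N ->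
  (cmd_bound d h r c <= cmd_bound d h r' c)%N.
Proof.
move=> rr'; elim: c => //= [c1 IH1 c2 IH2|e c1 IH1 c2 IH2|e c IH].
- exact: leq_add.
- by rewrite leq_add2l leq_add.
- by rewrite leq_mul // leq_add2l.
Qed.

(** A positive real has principal argument 0, so its complex power has no rotation. *)
Lemma cpow_real (R : realType) (a x : R) : 0 < a ->
  Normc.normc (Complex a 0) = a /\ cpow (Complex a 0) x = Complex (a `^ x) 0.
Proof.
move=> a0; have N : Normc.normc (Complex a 0) = a.
  by rewrite /= expr0n /= addr0 sqrtr_sqr gtr0_norm.
split => //; rewrite /cpow /carg N /= lexx divff ?gt_eqF // acos1.
by rewrite mulr0 cos0 sin0 mulr1 mulr0.
Qed.

Section Answers.
Context {R : realType} {disp : measure_display} {T : measurableType disp}.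
Variables (P : probability T R) (n d : nat) (w : 'I_n -> 'I_d -> {RV P >-> R}).
Variables (O : oracle d) (A c0 : nat) (f : nat -> nat -> nat).
Hypotheses (A_gt0 : (0 < A)%N) (w_ge0 : forall i j t, 0 <= w i j t).
Hypothesis (O_spec : oracle_spec w O).

(** At the real point 1/A the oracle returns an approximate Laplace transform. The imaginary part is
    recorded only to bound the size of the stored answer. *)
Lemma answer_laplace (i : 'I_n) k :
  let a := mean P (laplace A w (fun j => f k j) i) in
  let x := O (item_query d A c0 f n i k) in
  `|2 ^+ (n + c0) * a - x.1%:~R| <= 1 /\ `|x.2%:~R : R| <= 1.
Proof.
set q := item_query _ _ _ _ _ _ _ => a x.
have A0 : 0 < A%:R^-1 :> R by rewrite invr_gt0 ltr0n.
have phiE : qphi q = Complex A%:R^-1 0 :> R[i].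
  by rewrite /qphi /= mul0r mul1r.
have powE t : qpower w q i t = Complex (laplace A w (fun j => f k j) i t) 0.
  rewrite /qpower phiE (cpow_real _ A0).2 /laplace; congr (Complex (_ `^ _) 0).
  by apply: eq_bigr => j _; rewrite ffunE.
have bl : mbounded (laplace A w (fun j => f k j) i) by exact: laplace_mbounded.
have ReE : (fun t => complex.Re (qpower w q i t)) = laplace A w (fun j => f k j) i.
  by apply/funext => t; rewrite powE.
have ImE : (fun t => complex.Im (qpower w q i t)) = fun=> 0.
  by apply/funext => t; rewrite powE.
have [] := @O_spec q i.
- by [].
- by rewrite /= eqz_nat -lt0n.
- by rewrite phiE (cpow_real 0 A0).1 invf_le1 ?ler1n ?ltr0n.
- by right => j; rewrite /= ffunE.
- rewrite /cintegrable ReE ImE; split; first exact: mbounded_integrable.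
  exact: (mbounded_integrable P (mbounded_cst 0)).
rewrite /cexpectation ReE ImE /= -/x => H1 H2; split => //.
by move: H2; rewrite -/(mean P (fun=> 0)) mean_cst mulr0 sub0r normrN.
Qed.

End Answers.

(** The machine and the dynamic program index items by natural numbers; this extends a family on
    ['I_n] by a default value. *)
Definition at_ord (V : Type) (x0 : V) n (g : 'I_n -> V) (l : nat) : V :=
  oapp g x0 (insub l).

Lemma at_ordE V (x0 : V) n (g : 'I_n -> V) (i : 'I_n) : at_ord x0 g i = g i.
Proof. by rewrite /at_ord valK. Qed.

Lemma at_ord_ind V (x0 : V) n (g : 'I_n -> V) (Pr : V -> Prop) l :
  Pr x0 -> (forall i, Pr (g i)) -> Pr (at_ord x0 g l).
Proof. by move=> h0 h; rewrite /at_ord; case: insub => /=. Qed.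

Lemma weight_profit n (v : 'I_n -> nat) (X : pred nat) :
  weight (fun i => at_ord 0%N v i * 2 ^ n + 2 ^ i)%N X n =
  (1 + (profit v [set i : 'I_n | X i] * 2 ^ n + \sum_(l < n) X l * 2 ^ l))%N.
Proof.
rewrite /weight big_split /= /profit big_distrl /=; congr (1 + (_ + _))%N.
  by apply: eq_big => [i|i _]; rewrite ?inE // at_ordE.
by rewrite big_mkcond; apply: eq_bigr => l _; case: (X l); rewrite ?mul1n.
Qed.

(** The mask of the selected items is below [2 ^ n], so it can only break ties between equal
    profits. *)
Lemma weight_le_profit n (v : 'I_n -> nat) (X Y : pred nat) :
  let W i := (at_ord 0 v i * 2 ^ n + 2 ^ i)%N in
  (weight W X n <= weight W Y n)%N ->
  (profit v [set i : 'I_n | X i] <= profit v [set i : 'I_n | Y i])%N.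
Proof.
move=> W; rewrite !weight_profit leq_add2l => h.
have Y2 : (\sum_(l < n) Y l * 2 ^ l < 2 ^ n)%N.
  by apply: (@digits_lt 2 (fun l => Y l : nat)) => l _; case: (Y l).
rewrite -ltnS -(@ltn_pmul2r (2 ^ n)) ?expn_gt0 // mulSn.
by apply: leq_ltn_trans (leq_trans (leq_addr _ _) h) _; rewrite addnC ltn_add2r.
Qed.

Lemma weight_bit n (v : 'I_n -> nat) (X : pred nat) (i : 'I_n) :
  ((weight (fun i => at_ord 0%N v i * 2 ^ n + 2 ^ i)%N X n).-1 %/ 2 ^ i %% 2)%N = X i.
Proof.
rewrite weight_profit (@digits_nth 2 isT (fun l => X l : nat)) //.
by move=> l _; case: (X l).
Qed.

(** For the full set the weight is 2^n (V + 1) with V the total profit, and V + 1 is at most the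
    product of the [v i + 1], hence at most 2 to the total length of the profits. *)
Lemma weight_lt n (v : 'I_n -> nat) :
  (weight (fun i => at_ord 0%N v i * 2 ^ n + 2 ^ i)%N xpredT n <= 2 ^ input_size v)%N.
Proof.
rewrite weight_profit /input_size expnD.
have -> : (\sum_(l < n) xpredT (l : nat) * 2 ^ l = (2 ^ n).-1)%N.
  by rewrite predn_exp mul1n; apply: eq_bigr => l _; rewrite mul1n.
set y := profit _ _; have -> : (1 + (y * 2 ^ n + (2 ^ n).-1) = 2 ^ n * y.+1)%N.
  by rewrite mulnS [(y * _)%N]mulnC addnCA add1n prednK ?expn_gt0 // addnC.
rewrite leq_mul2l /y {y}; apply/orP; right.
have -> : profit v [set i : 'I_n | xpredT (i : nat)] = (\sum_(i < n) v i)%N.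
  by apply: eq_bigl => i; rewrite inE.
elim/big_rec2: _ => [//|i z x _ zx].
rewrite expnD; apply: leq_trans (_ : ((v i).+1 * x.+1 <= _)%N).
  by rewrite mulSn mulnS; lia.
by rewrite leq_mul // (abs_lt_bits (v i)%:Z).
Qed.

(** * Optimality and feasibility on one instance *)

Section Instance.
Context {R : realType} {disp : measure_display} {T : measurableType disp}.
Variables (P : probability T R) (n d : nat) (v : 'I_n -> nat).
Variables (w : 'I_n -> 'I_d -> {RV P >-> R}) (O : oracle d).
Variables (eps gamma delta : R) (thr : int) (D0 A K : nat).
Variables (f : nat -> 'I_d -> nat) (c : nat -> int) (C c0 : nat).
Hypotheses (gamma_le1 : gamma <= 1) (A_gt0 : (0 < A)%N) (D0_gt0 : (0 < D0)%N).
Hypotheses (w_ge0 : forall i j t, 0 <= w i j t) (O_spec : oracle_spec w O).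
Hypothesis thr_lo : thr%:~R <= D0%:R * (gamma - 2 * delta).
Hypothesis thr_hi : forall x : R, 0 <= x -> thr%:~R <= D0%:R * (x + 2 * delta) ->
  (1 - eps) * gamma <= x.

Let score (S : {set 'I_n}) : R :=
  \sum_(k < K) (c k)%:~R * \prod_(i in S) mean P (laplace A w (f k) i).

Hypothesis score_fits : forall S,
  fine (P (fits w S 1)) - delta <= score S <= fine (P (fits w S (1 + eps))) + delta.
Hypotheses (C_gt0 : (0 < C)%N) (C_delta : (\sum_(k < K) `|c k|)%N%:R <= delta * C%:R)
  (c0_C : (2 * C < 2 ^ c0)%N).

Let M := (C * n.+1)%N.
Let B := M.+1.
Let L := (B ^ K)%N.
Let p := (n + c0)%N.
Let g k j := at_ord 0%N (f k) j.
Let gE k : (fun j : 'I_d => g k j) = f k.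
Proof. by apply/funext => j; rewrite /g at_ordE. Qed.

Let ans i k : int := (O (item_query d A c0 g n i k)).1.
(** An answer may be as low as -1; the shift makes it nonnegative and never less than [2 ^ p] times
    the mean. *)
Let b i k : nat := at_ord 0%N (fun i : 'I_n => `|(ans i k + 1)%R|%N) i.
Let a i k : R := at_ord 0 (fun i : 'I_n => mean P (laplace A w (f k) i)) i.

Let a01 i k : 0 <= a i k <= 1.
Proof.
rewrite /a; apply: (at_ord_ind (Pr := fun x : R => 0 <= x <= 1)) => [|l].
  by rewrite lexx ler01.
have bl : mbounded (laplace A w (f k) l) by exact: laplace_mbounded.
apply/andP; split; [rewrite -(mean_cst P 0)|rewrite -(mean_cst P 1)];
  by apply: le_mean => // [|t]; [exact: mbounded_cst|
     case/andP: (laplace_ge0_le1 A_gt0 w_ge0 (f k) l t)].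
Qed.

Let ansP (i : 'I_n) k : [/\ `|2 ^+ p * a i k - (ans i k)%:~R| <= 1,
  ans i k + 1 = (b i k)%:Z, (b i k <= 2 ^ p + 2)%N &
  (`|(O (item_query d A c0 g n i k)).2| <= 1)%N].
Proof.
have [] := answer_laplace c0 g A_gt0 w_ge0 O_spec i k.
rewrite gE -/(ans i k) => H1 H2; have /andP[a0 a1] := a01 i k.
have aE : a i k = mean P (laplace A w (f k) i) by rewrite /a at_ordE.
rewrite -aE in H1; have p0 : 0 < 2 ^+ p :> R by rewrite exprn_gt0.
have /andP[H3 H4] : 0 <= ans i k + 1 <= (2 ^ p + 2)%N%:Z.
  move: H1; rewrite ler_norml => /andP[H1 H1'].
  have pa0 : 0 <= 2 ^+ p * a i k by rewrite mulr_ge0 // ltW.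
  have pa1 : 2 ^+ p * a i k <= 2 ^+ p by rewrite ler_piMr // ltW.
  rewrite -!(ler_int R) intrD; apply/andP; split; first by lra.
  by rewrite -pmulrn natrD natrX; lra.
have bE : ans i k + 1 = (b i k)%:Z by rewrite /b at_ordE gez0_abs.
split => //; first by rewrite -lez_nat -bE.
by move: H2; rewrite -intr_norm -[1]/(1%:~R) ler_int.
Qed.

Let b_a i k : `|2 ^+ p * a i k - ((b i k)%:R - 1)| <= 1.
Proof.
case: (ltnP i n) => [lin|nli].
  have [H1 /(congr1 (fun z : int => z%:~R : R))] := ansP (Ordinal lin) k.
  rewrite intrD => bE _ _.
  by rewrite -[(b i k)%:R]/((b (Ordinal lin) k)%:Z%:~R) -bE addrK.
(* Beyond the items both defaults are 0, and the error |0 - (0 - 1)| is exactly the 1 allowed. *)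
by rewrite /a /b /at_ord insubF /= ?ltnNge ?nli // mulr0 !sub0r opprK normr1.
Qed.

Let b_le i k : (b i k <= 2 ^ p + 2)%N.
Proof.
case: (ltnP i n) => [lin|nli]; first by case: (ansP (Ordinal lin) k).
by rewrite /b /at_ord insubF // ltnNge nli.
Qed.

Let M_p : (2 * M < 2 ^ p)%N.
Proof.
rewrite /M /p mulnA expnD mulnC; apply: (@leq_ltn_trans (2 ^ n * (2 * C))%N).
  by rewrite leq_mul2r ltn_expl // orbT.
by rewrite ltn_pmul2l ?expn_gt0.
Qed.

Let W i := (at_ord 0%N v i * 2 ^ n + 2 ^ i)%N.
Let tr := shrink B K p b.
Let start := L.-1.
Let tab := table L start tr W.
Let accepted : pred nat := fun j =>
  thr * M%:Z <= D0%:Z * \sum_(k < K) c k * (digit B k j)%:Z.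
Let best := scan accepted (tab (n * L)) (n * L) L.
Let tr_lt i s : (s < L)%N -> (tr i s < L)%N.
Proof. by move=> _; exact: shrink_lt. Qed.
Let start_lt : (start < L)%N. Proof. by rewrite ltn_predL expn_gt0. Qed.
Let L_gt0 : (0 < L)%N. Proof. by rewrite expn_gt0. Qed.

Let set_of (X : pred nat) : {set 'I_n} := [set i : 'I_n | X i].

(** Each digit is off by at most [n], so the combination is off by at most [n] times the sum of the
    |c k|; the choices of [C] and of [M = C * n.+1] bring this below [delta * M]. *)
Let score_error (X : pred nat) :
  `|(\sum_(k < K) c k * (digit B k (n * L + node start tr X n))%:Z)%:~R
    - M%:R * score (set_of X)| <= delta * M%:R.
Proof.
have pE k : \prod_(i in set_of X) mean P (laplace A w (f k) i) = \prod_(l < n | X l) a l k.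
  by apply: eq_big => [i|i _]; rewrite ?inE // /a at_ordE.
rewrite /score mulr_sumr rmorph_sum -sumrB.
apply: (le_trans (ler_norm_sum _ _ _)).
have Cn : (\sum_(k < K) `|c k|)%N%:R * n%:R <= delta * M%:R.
  have S0 : 0 <= (\sum_(k < K) `|c k|)%N%:R :> R by [].
  rewrite /M natrM mulrA ler_pM // ler_nat //.
apply: le_trans Cn; rewrite natr_sum mulr_suml; apply: ler_sum => k _.
rewrite pE /= intrM mulrCA -mulrBr normrM natr_absz intr_norm ler_wpM2l //.
rewrite -pmulrn -[digit B k _](digit_mod M _ (ltn_ord k)) modnMDl.
rewrite modn_small; last exact: node_lt.
exact: (rounding_error M_p b_le X a01 b_a).
Qed.

Let M_gt0 : 0 < M%:R :> R. Proof. by rewrite ltr0n muln_gt0 C_gt0. Qed.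

Let acceptE j : accepted j =
  (thr%:~R * M%:R <= D0%:R * (\sum_(k < K) c k * (digit B k j)%:Z)%:~R :> R).
Proof. by rewrite /accepted -(ler_int R) !intrM. Qed.

(** The node reached by a feasible set passes the test, so [best] is at least the entry there, even
    if another set with the same rounded products has displaced it. *)
Let feasible_le (S : {set 'I_n}) : (gamma%:E <= P (fits w S 1))%E ->
  exists2 X, S = set_of X & (weight W X n <= best)%N.
Proof.
move=> feas; pose X l := [exists i in S, val i == l].
have SX : S = set_of X.
  apply/setP => i; rewrite inE; apply/idP/existsP => [iS|]; first by exists i; rewrite iS eqxx.
  by move=> [i' /andP[iS /eqP/val_inj <-]].
exists X => //.
have gP : gamma <= fine (P (fits w S 1)).
  by rewrite -lee_fin fineK // fin_num_measure //; exact: fits_measurable.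
have nl : (node start tr X n < L)%N by exact: node_lt.
apply: (@leq_trans (tab (n * L) (n * L + node start tr X n))).
  apply: table_complete => //; case: (n) => //= m; rewrite mulSn addnC ltn_add2r.
  exact: node_lt.
apply: scan_complete; first by rewrite leq_addr ltn_add2l.
rewrite acceptE; have /andP[lo _] := score_fits S.
have := score_error X; rewrite -SX ler_norml => /andP[e1 _].
set s := (\sum_(k < K) _)%:~R in e1 *.
have D0' : 0 < D0%:R :> R by rewrite ltr0n.
apply: (@le_trans _ _ (D0%:R * (gamma - 2 * delta) * M%:R)); first by rewrite ler_pM2r.
rewrite -mulrA ler_pM2l //.
have : M%:R * (gamma - delta) <= M%:R * score S by rewrite ler_pM2l // (le_trans _ lo) // lerB.
move: e1; rewrite mulrC; lra.
Qed.

(** Soundness of the table yields a set attaining [best]. Its node was accepted, which bounds its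
    score and hence its probability from below, and it outweighs every feasible set. *)
Lemma best_set : (0 < best)%N ->
  exists S : {set 'I_n},
  [/\ (optimum v w gamma <= profit v S)%N,
      ((1 - eps) * gamma)%:E <= P (fits w S (1 + eps)) &
      forall i : 'I_n, (best.-1 %/ 2 ^ i %% 2)%N = (i \in S)]%E.
Proof.
move=> best0; have [j [jn aj bE]] := scan_sound best0.
have [|X [jE TX]] := @table_sound L start tr W start_lt tr_lt (n * L) j.
  by rewrite -/tab -bE.
have jLn : (j %/ L = n)%N.
  move: jn => /andP[nj jn]; apply/eqP; rewrite eqn_leq -ltnS ltn_divLR // leq_divRL //.
  by rewrite nj mulSn addnC jn.
rewrite jLn in jE TX.
have bX : best = weight W X n := etrans bE TX.
exists (set_of X); split.
- apply/bigmax_leqP => S /feasible_le[Y -> Yb].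
  by apply: weight_le_profit; rewrite -bX.
- have mF := fits_measurable w (set_of X) (1 + eps).
  rewrite -[P _]fineK ?fin_num_measure // lee_fin; apply: thr_hi; first exact: fine_ge0.
  have /andP[_ hi] := score_fits (set_of X).
  move: aj; rewrite acceptE; have := score_error X; rewrite -jE ler_norml => /andP[_ e2].
  set s := (\sum_(k < K) _)%:~R in e2 *; move=> aj.
  rewrite -(ler_pM2r M_gt0) (le_trans aj) // -mulrA ler_pM2l ?ltr0n //.
  have : M%:R * score (set_of X) <= M%:R * (fine (P (fits w (set_of X) (1 + eps))) + delta).
    by rewrite ler_pM2l.
  move: e2; lra.
- by move=> i; rewrite bX weight_bit inE.
Qed.

(** The empty set fits with probability 1, and [gamma <= 1]. Hence the scan accepts some node with a
    nonzero entry. *)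
Lemma best_gt0 : (0 < best)%N.
Proof.
have [|X _] := @feasible_le finset.set0; last by apply: leq_trans.
have -> : fits w finset.set0 1 = setT.
  by apply/seteqP; split => // t _ j; rewrite big_set0.
by rewrite probability_setT lee_fin.
Qed.

Lemma input_item (l : nat) : input v 1 l%:Z = (at_ord 0%N v l)%:Z.
Proof.
rewrite /input /=; case: pickP => [i|no]; first by rewrite eqz_nat => /eqP ->; rewrite at_ordE.
rewrite /at_ord; case: insubP => //= i _ il.
by have := no i; rewrite -il eqxx.
Qed.

Lemma input_bounded h : (input_size v < h)%N -> bounded h (input v).
Proof.
move=> Nh x z.
have small m : (m <= input_size v)%N -> (2 ^ m <= 2 ^ h)%N.
  by move=> mN; rewrite leq_exp2l // (leq_trans mN) // ltnW.
rewrite /input; case: ifP => _ /=.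
  by rewrite (leq_trans (ltn_expl n (isT : 1 < 2)%N)) // small // leq_addr.
case: ifP => _; last by rewrite expn_gt0.
case: pickP => [i _|_]; last by rewrite expn_gt0.
rewrite (leq_trans (abs_lt_bits (v i)%:Z)) // small //.
by rewrite /input_size (bigD1 i) //= addnCA leq_addr.
Qed.

Lemma knapsack_cmd_spec h :
  (p.+1 < h)%N -> (input_size v < h)%N -> (n.+1 * L < 2 ^ h)%N ->
  (forall k j, (k < K)%N -> (j < d)%N -> (g k j < 2 ^ h)%N) ->
  wp O h (n.+1 * L) (knapsack_cmd d K A C c0 D0 thr g c)
    (fun s => (optimum v w gamma <= profit v (output n s))%N /\
       (((1 - eps) * gamma)%:E <= P (fits w (output n s) (1 + eps)))%E) (input v).
Proof.
move=> ph Nh rh gh.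
have [S [optS feasS bitS]] := best_set best_gt0.
have ans_lt i k : (i < n)%N -> (k < K)%N ->
    (`|(O (item_query d A c0 g n i k)).1| < 2 ^ h)%N /\
    (`|(O (item_query d A c0 g n i k)).2| < 2 ^ h)%N.
  move=> lin _; have [_ bE bl H2] := ansP (Ordinal lin) k.
  have ph' : (2 ^ p.+1 + 2 ^ p.+1 <= 2 ^ h)%N by rewrite addnn -mul2n -expnS leq_exp2l.
  have p1 : (0 < 2 ^ p)%N by rewrite expn_gt0.
  rewrite expnS in ph'; split; last by apply: leq_ltn_trans H2 _; lia.
  by move: bE bl; rewrite /ans /=; lia.
have W_h : (weight W xpredT n < 2 ^ h)%N.
  by apply: leq_ltn_trans (weight_lt v) _; rewrite ltn_exp2l.
apply: wp_mono (@knapsack_cmd_correct d K A C c0 D0 thr g c O n (at_ord 0%N v) h b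
  _ ans_lt M_p b_le _ _ gh rh W_h (input v) _ _ _ _ best_gt0) => //.
- move=> s' _ _ s2.
  suff -> : output n s' = S by split.
  by apply/setP => i; rewrite inE s2 // bitS; case: (i \in S).
- by move=> i k lin _; have [_ bE _ _] := ansP (Ordinal lin) k.
- by apply: leq_trans Nh.
- exact: ltn_trans ph.
- exact: input_bounded.
- by move=> i _; exact: input_item.
- by move=> x z; rewrite /input; case: x => [//|[//|x]].
Qed.

End Instance.

Theorem theorem9 (R : realType) (d : nat) (eps gamma : R)
    (eps_gt0 : 0 < eps) (gamma_ge0 : 0 <= gamma) (gamma_le1 : gamma <= 1) :
  exists (c : cmd) (p : {poly nat}),
    forall (disp : measure_display) (T : measurableType disp)
           (P : probability T R) (n : nat) (v : 'I_n -> nat)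
           (w : 'I_n -> 'I_d -> {RV P >-> R}) (O : oracle d),
      (forall i j t, 0 <= w i j t) ->
      mutually_independent w ->
      oracle_spec w O ->
      exists (s : store) (t : nat),
        [/\ exec O c (input v) s t,
            (t <= p.[input_size v])%N,
            (1 - eps) * (optimum v w gamma)%:R
              <= (profit v (output n s))%:R :> R
          & (((1 - eps) * gamma)%:E <= P (fits w (output n s) (1 + eps)))%E].
Proof.
have [delta [thr [D0 [d01 D00 lo hi]]]] : exists (delta : R) (thr : int) (D : nat),
    [/\ 0 < delta <= 1, (0 < D)%N, thr%:~R <= D%:R * (gamma - 2 * delta) &
    forall x : R, 0 <= x -> thr%:~R <= D%:R * (x + 2 * delta) -> (1 - eps) * gamma <= x].
  by apply: threshold_exists => //; rewrite gamma_ge0.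
have [A [K [f [c [A0 score]]]]] := fits_estimate d eps_gt0 d01.
have /andP[delta0 delta1] := d01.
have [C [C0 C_delta]] : exists C : nat, (0 < C)%N /\
    (\sum_(k < K) `|c k|)%N%:R <= delta * C%:R.
  exists (Num.truncn ((\sum_(k < K) `|c k|)%N%:R / delta)).+1; split => //.
  by rewrite mulrC -ler_pdivrMr //; exact/ltW/truncnS_gt.
pose c0 := (2 * C)%N.
pose g k j := at_ord 0%N (f k) j.
have [F FP] : exists F, forall k j, (k < K)%N -> (j < d)%N -> (g k j < 2 ^ F)%N.
  exists (\sum_(k < K) \sum_(j < d) g k j)%N => k j kK jd.
  apply: leq_ltn_trans (ltn_expl _ _) => //.
  rewrite (bigD1 (Ordinal kK)) //= (bigD1 (Ordinal jd)) //=.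
  by rewrite -addnA leq_addr.
(* The first two summands give room for node indices up to (n + 1) L; the last group covers oracle
   answers of [n + c0] digits and the frequencies, which are below [2 ^ F]. *)
pose h N := (N + (C + N) * K + (N + c0 + F + 2))%N.
pose r N := (N.+1 * (C * N.+1).+1 ^ K)%N.
pose prog := knapsack_cmd d K A C c0 D0 thr g c.
have poly_S : polyb (fun N => N.+1) by exact: (polybD (polyb_cst 1) polyb_id).
have poly_h : polyb h.
  have poly_C := polybM (polybD (polyb_cst C) polyb_id) (polyb_cst K).
  have poly_c := polybD (polybD (polybD polyb_id (polyb_cst c0)) (polyb_cst F)) (polyb_cst 2).
  exact: (polybD (polybD polyb_id poly_C) poly_c).
have poly_r : polyb r.
  exact: (polybM poly_S (polybX K (polybD (polyb_cst 1) (polybM (polyb_cst C) poly_S)))).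
have [q qP] := polyb_cmd_bound d prog poly_h poly_r.
exists prog, q => disp T P n v w O w0 indep Ospec; pose N := input_size v.
have nN : (n <= N)%N by exact: leq_addr.
have h0 : ((n + c0).+1 < h N)%N by rewrite /h; lia.
have hN : (N < h N)%N by rewrite /h; lia.
have rh : (n.+1 * (C * n.+1).+1 ^ K < 2 ^ h N)%N.
  apply: (@leq_ltn_trans (2 ^ (N + (C + N) * K))%N); last by rewrite ltn_exp2l // /h; lia.
  rewrite expnD leq_mul //; first by rewrite (leq_ltn_trans nN) // ltn_expl.
  rewrite expnM leq_expn2r // expnD.
  apply: (@leq_trans (C.+1 * n.+1)%N); first by rewrite mulSn; lia.
  apply: leq_mul; first exact: ltn_expl.
  by rewrite (leq_trans (ltn_expl n (isT : (1 < 2)%N))) // leq_exp2l.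
have gh k j : (k < K)%N -> (j < d)%N -> (g k j < 2 ^ h N)%N.
  by move=> kK jd; rewrite (leq_trans (FP k j kK jd)) // leq_exp2l // /h; lia.
have [s [t [ex tb _ [opt feas]]]] := knapsack_cmd_spec gamma_le1 A0 D00 w0 Ospec lo hi
  (fun S => score _ _ P n w S w0 indep) C0 C_delta (ltn_expl (2 * C) (isT : (1 < 2)%N)) h0 hN rh gh.
exists s, t; split => //.
(* The loops were bounded in terms of [n], the polynomial in terms of the input size [N >= n];
   monotonicity in [r] bridges the two. *)
- apply: leq_trans (qP N); apply: leq_trans tb _; apply: cmd_bound_mono.
  apply: leq_mul => //; apply: leq_expn2r.
  by rewrite ltnS leq_mul2l ltnS nN orbT.
- apply: (@le_trans _ _ (optimum v w gamma)%:R); last by rewrite ler_nat.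
  by rewrite ler_piMl // gerBl ltW.
Qed.
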